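(* Let $m,n$ be nonnegative integers, let $i<m$, and let $f:\subseteq\mathbf R^m\to\mathbf R^n$ be an analytic function with open domain. Write $e_i\in\mathbf N^m$ for the vector whose $i$-th component is $1$ and whose other components are $0$. For a nonzero ''polynomial'' $P=(P_0,\dots,P_{n-1})$ in $k$ arguments (see context), write the condition $$(\ast)_x:\quad P\bigl(f x,\ \mathrm D^{e_i}f x,\ \mathrm D^{2e_i}f x,\ \dots,\ \mathrm D^{(k-1)e_i} f x\bigr)=0 .$$ Consider the statements: (i) for every open connected set $J\subseteq\operatorname{dom} f$ there is a nonzero $\mathbf Z^n$-coefficient polynomial $P$ such that $(\ast)_x$ holds for all $x\in J$; (ii) for each $x_0\in\operatorname{dom} f$ there are a nonzero $\mathbf Z^n$-coefficient polynomial $P$ and an open set $J$ containing $x_0$ such that $(\ast)_x$ holds for all $x\in J$; (iii) for each $x_0\in\operatorname{dom} f$ there are a nonzero $\mathbf Z^n$-coefficient polynomial $P$ and an open interval $J\subseteq\mathbf R$ containing the $i$-th component of $x_0$ such that $(\ast)_x$ holds for all $x$ whose $i$-th component lies in $J$ and whose other components equal those of $x_0$; (iv) for each $x\in\operatorname{dom} f$ there is a nonzero $\mathbf Z^n$-coefficient polynomial $P$ such that $(\ast)_x$ holds; and let (i$_\mathbf R$), (ii$_\mathbf R$), (iii$_\mathbf R$) be the statements obtained from (i), (ii), (iii) by replacing ''$\mathbf Z^n$-coefficient'' with ''$\mathbf R^n$-coefficient''. Then (i), (ii), (iii), (iv), (i$_\mathbf R$), (ii$_\mathbf R$), (iii$_\mathbf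 R$) are all equivalent.
   Context: Functions may be partial: $f:\subseteq\mathbf R^m\to\mathbf R^n$ means $f$ is defined on a set $\operatorname{dom} f\subseteq\mathbf R^m$. A function with open domain is analytic if near every point of its domain it is given by a convergent multivariate power series. For analytic $f$ and $a=(a_0,\dots,a_{m-1})\in\mathbf N^m$, $\mathrm D^a f$ denotes the mixed partial derivative of order $a_j$ in the $j$-th variable. A nonzero $\mathbf Z^n$-coefficient (resp. $\mathbf R^n$-coefficient) polynomial $P$ in $k$ arguments means an $n$-tuple $P=(P_0,\dots,P_{n-1})$ of nonzero polynomials in $k$ real variables with integer (resp. real) coefficients; for $y_0,\dots,y_{k-1}\in\mathbf R^n$, $P(y_0,\dots,y_{k-1})$ is the vector in $\mathbf R^n$ whose $j$-th component is $P_j$ evaluated at the $j$-th components of $y_0,\dots,y_{k-1}$. (Here $\mathbf N=\{0,1,2,\dots\}$.) *)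

(* Defs.v *)
From Stdlib Require Import Reals Lra Lia ZArith Arith Classical ClassicalEpsilon.
From Stdlib Require Fin.
Open Scope R_scope.

Definition vec (m : nat) := Fin.t m -> R.
Definition mindex (m : nat) := Fin.t m -> nat.

Definition fval {k : nat} (j : Fin.t k) : nat := proj1_sig (Fin.to_nat j).

Definition fin_cons {A : Type} {k : nat} (e : A) (a : Fin.t k -> A) : Fin.t (S k) -> A :=
  fun j => Fin.caseS' j (fun _ => A) e a.

Fixpoint sum_box (k d : nat) : (mindex k -> R) -> R :=
  match k with
  | O => fun F => F (fun j => Fin.case0 (fun _ => nat) j)
  | S k' => fun F => sum_f_R0 (fun e => sum_box k' d (fun a => F (fin_cons e a))) d
  end.

Fixpoint prod_fin (k : nat) : (Fin.t k -> R) -> R :=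
  match k with
  | O => fun _ => 1
  | S k' => fun y => y Fin.F1 * prod_fin k' (fun j => y (Fin.FS j))
  end.

Definition in_box {k : nat} (d : nat) (a : mindex k) : Prop := forall j, (a j <= d)%nat.

(** * Polynomials in k real variables: a degree bound and the coefficients of
    the monomials X^a with all exponents <= the bound (coefficients outside
    the box are irrelevant). *)
Record mpoly (k : nat) : Type := MPoly { mp_deg : nat; mp_coef : mindex k -> R }.
Arguments mp_deg {k}.
Arguments mp_coef {k}.

Definition mp_eval {k : nat} (P : mpoly k) (y : Fin.t k -> R) : R :=
  sum_box k (mp_deg P) (fun a => mp_coef P a * prod_fin k (fun j => y j ^ a j)).

Definition mp_nonzero {k : nat} (P : mpoly k) : Prop :=
  exists a, in_box (mp_deg P) a /\ mp_coef P a <> 0.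

Definition mp_intcoef {k : nat} (P : mpoly k) : Prop :=
  forall a, in_box (mp_deg P) a -> exists z : Z, mp_coef P a = IZR z.

Definition in_ball {m : nat} (x : vec m) (r : R) (y : vec m) : Prop :=
  forall j, Rabs (y j - x j) < r.

Definition is_open {m : nat} (U : vec m -> Prop) : Prop :=
  forall x, U x -> exists r, 0 < r /\ forall y, in_ball x r y -> U y.

Definition is_connected {m : nat} (J : vec m -> Prop) : Prop :=
  forall U V : vec m -> Prop, is_open U -> is_open V ->
    (forall x, J x -> U x \/ V x) ->
    (forall x, J x -> U x -> V x -> False) ->
    (exists x, J x /\ U x) -> (exists x, J x /\ V x) -> False.

(** * Analyticity: near x0, g is the sum of an (absolutely) convergent power
    series sum_a c_a (y - x0)^a, the multiple series being summed over the
    boxes {0..d}^m. *)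
Definition analytic_at {m : nat} (dom : vec m -> Prop) (g : vec m -> R) (x0 : vec m) : Prop :=
  exists (r : R) (c : mindex m -> R), 0 < r /\
    forall y, in_ball x0 r y ->
      dom y /\
      let t := fun a : mindex m => c a * prod_fin m (fun j => (y j - x0 j) ^ a j) in
      (exists B, forall d, sum_box m d (fun a => Rabs (t a)) <= B) /\
      Un_cv (fun d => sum_box m d t) (g y).

Definition analytic {m n : nat} (dom : vec m -> Prop) (f : vec m -> vec n) : Prop :=
  is_open dom /\ forall x0, dom x0 -> forall j : Fin.t n, analytic_at dom (fun x => f x j) x0.

Definition upd {m : nat} (x : vec m) (i : Fin.t m) (t : R) : vec m :=
  fun j => if Fin.eq_dec j i then t else x j.

(** the partial derivative of g in the i-th variable at x (when it exists;
    an arbitrary value otherwise) *)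
Definition pderiv {m : nat} (i : Fin.t m) (g : vec m -> R) (x : vec m) : R :=
  epsilon (inhabits 0) (fun l => derivable_pt_lim (fun t => g (upd x i t)) (x i) l).

Fixpoint pderivn {m : nat} (i : Fin.t m) (k : nat) (g : vec m -> R) : vec m -> R :=
  match k with
  | O => g
  | S k' => pderiv i (pderivn i k' g)
  end.

Definition star {m n k : nat} (f : vec m -> vec n) (i : Fin.t m)
    (P : Fin.t n -> mpoly k) (x : vec m) : Prop :=
  forall j : Fin.t n,
    mp_eval (P j) (fun l : Fin.t k => pderivn i (fval l) (fun z => f z j) x) = 0.

Definition admissible {n k : nat} (intc : bool) (P : Fin.t n -> mpoly k) : Prop :=
  forall j, mp_nonzero (P j) /\ (if intc then mp_intcoef (P j) else True).

Definition stmt_i {m n : nat} (intc : bool) (dom : vec m -> Prop) (f : vec m -> vec n)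
    (i : Fin.t m) : Prop :=
  forall J : vec m -> Prop, is_open J -> is_connected J -> (forall x, J x -> dom x) ->
    exists (k : nat) (P : Fin.t n -> mpoly k), admissible intc P /\
      forall x, J x -> star f i P x.

Definition stmt_ii {m n : nat} (intc : bool) (dom : vec m -> Prop) (f : vec m -> vec n)
    (i : Fin.t m) : Prop :=
  forall x0, dom x0 ->
    exists (k : nat) (P : Fin.t n -> mpoly k) (J : vec m -> Prop),
      admissible intc P /\ is_open J /\ J x0 /\ (forall x, J x -> dom x) /\
      forall x, J x -> star f i P x.

Definition stmt_iii {m n : nat} (intc : bool) (dom : vec m -> Prop) (f : vec m -> vec n)
    (i : Fin.t m) : Prop :=
  forall x0, dom x0 ->
    exists (k : nat) (P : Fin.t n -> mpoly k) (a b : R),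
      admissible intc P /\ a < x0 i < b /\
      forall t, a < t < b -> dom (upd x0 i t) -> star f i P (upd x0 i t).

Definition stmt_iv {m n : nat} (dom : vec m -> Prop) (f : vec m -> vec n)
    (i : Fin.t m) : Prop :=
  forall x, dom x ->
    exists (k : nat) (P : Fin.t n -> mpoly k), admissible true P /\ star f i P x.

(* Main.v *)
(* The chain is (i) => (ii) => (iii) => (iv) => (i), with (i) => (i_R) => (ii_R) => (iii_R) => (iv).

   (iv) => (i): there are only countably many integer polynomials, and each defines a relatively
   closed subset of J on which the relation holds; by Baire one of these sets contains a ball,
   and by analytic continuation along segments the relation spreads over the connected J.

   (iii_R) => (iv): differentiating a real relation for h = f_j on a line in its leading variable
   until the separant S is not identically zero, one can solve for the next derivative on a
   subinterval; there the ring generated over Z by the coefficients of the relation,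
   h, ..., h^(k) and 1/S is stable under d/dt, so it contains all derivatives of h.  It has
   finitely many, say q, generators, so by counting monomials the q+1 functions h, ..., h^(q)
   satisfy a nonzero integer relation, which extends analytically to the whole segment up to
   the given point. *)

From Stdlib Require Import Reals Lra Lia ZArith Arith List Classical ClassicalEpsilon.
From Stdlib Require Import FunctionalExtensionality Ranalysis5 PSeries_reg Cantor FinFun.
From Stdlib Require Fin.
From Coquelicot Require Import Coquelicot.
Require Import Defs.
Open Scope R_scope.

(** * Box sums and finite products *)

(** The components of [f] are treated separately, and their relations are then brought to a common
    number of arguments by adding variables that do not occur. Since [pderiv] is an arbitrary value
    where no derivative exists, everything rests on expanding all derivatives along coordinate i in
    one neighbourhood, with one majorant for all orders. Continuation in several variables is
    reduced to one variable: on a line the multiple series regroups into a power series in the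
    parameter.

    In (iii_R) => (iv) the obstacle is that the coefficients of the given relation may be
    transcendental. Adjoined as constant functions they cost only finitely many generators, and
    counting monomials is an elementary form of the bound q on the transcendence degree: it
    eliminates the coefficients without ever choosing a transcendence basis. The subinterval where
    the separant is nonzero may miss the given point, so the integer relation has to be continued to
    it. In (iv) the degree and the number of arguments may change from point to point; the countable
    cover absorbs this. *)

Lemma fin_caseS {k} (P : Fin.t (S k) -> Prop) :
  P Fin.F1 -> (forall j, P (Fin.FS j)) -> forall j, P j.
Proof. intros H0 HS j. apply (Fin.caseS' j P); auto. Qed.

Lemma fin_cons_eta {A} {k} (a : Fin.t (S k) -> A) :
  fin_cons (a Fin.F1) (fun j => a (Fin.FS j)) = a.
Proof.
  apply functional_extensionality; intro j; revert j.
  apply fin_caseS; reflexivity.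
Qed.

Lemma mindex0_eq (a b : mindex 0) : a = b.
Proof.
  apply functional_extensionality; intro j; apply (Fin.case0 (fun j => a j = b j) j).
Qed.

Lemma in_box_cons {k} d e (a : mindex k) :
  in_box d (fin_cons e a) <-> (e <= d)%nat /\ in_box d a.
Proof.
  split.
  - intros H; split; [apply (H Fin.F1) | intros j; apply (H (Fin.FS j))].
  - intros [H1 H2]; unfold in_box; apply fin_caseS; [apply H1 | apply H2].
Qed.

Lemma sum_box_ext {k} d (F G : mindex k -> R) :
  (forall a, in_box d a -> F a = G a) -> sum_box k d F = sum_box k d G.
Proof.
  induction k as [|k IH]; simpl; intros H.
  - apply H. intros j; apply (Fin.case0 (fun j => _ j <= d)%nat j).
  - apply sum_eq; intros e He. apply IH; intros a Ha. apply H, in_box_cons; auto.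
Qed.

Lemma sum_box_plus {k} d (F G : mindex k -> R) :
  sum_box k d (fun a => F a + G a) = sum_box k d F + sum_box k d G.
Proof.
  induction k as [|k IH]; simpl; [reflexivity|].
  rewrite <- sum_plus; apply sum_eq; intros e _. apply IH.
Qed.

Lemma sum_box_scal {k} d x (F : mindex k -> R) :
  sum_box k d (fun a => x * F a) = x * sum_box k d F.
Proof.
  induction k as [|k IH]; simpl; [reflexivity|].
  rewrite scal_sum; apply sum_eq; intros e _. rewrite IH; ring.
Qed.

Lemma sum_box_minus {k} d (F G : mindex k -> R) :
  sum_box k d (fun a => F a - G a) = sum_box k d F - sum_box k d G.
Proof.
  unfold Rminus. rewrite sum_box_plus. f_equal.
  rewrite <- (Rmult_1_l (sum_box k d G)), Ropp_mult_distr_l, <- sum_box_scal.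
  apply sum_box_ext; intros; ring.
Qed.

Lemma sum_box_le {k} d (F G : mindex k -> R) :
  (forall a, F a <= G a) -> sum_box k d F <= sum_box k d G.
Proof.
  induction k as [|k IH]; simpl; intros H; [apply H|].
  apply sum_Rle; intros e _; apply IH; intros; apply H.
Qed.

Lemma sum_box_abs {k} d (F : mindex k -> R) :
  Rabs (sum_box k d F) <= sum_box k d (fun a => Rabs (F a)).
Proof.
  induction k as [|k IH]; simpl; [apply Rle_refl|].
  eapply Rle_trans; [apply Rsum_abs|].
  apply sum_Rle; intros e _; apply IH.
Qed.

Lemma sum_box_nonneg {k} d (F : mindex k -> R) :
  (forall a, 0 <= F a) -> 0 <= sum_box k d F.
Proof.
  induction k as [|k IH]; simpl; intros H; [apply H|].
  apply cond_pos_sum; intros e; apply IH; intros; apply H.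
Qed.

Lemma sum_mono (u : nat -> R) d d' :
  (d <= d')%nat -> (forall e, 0 <= u e) -> sum_f_R0 u d <= sum_f_R0 u d'.
Proof.
  intros Hd H; induction Hd as [|d' Hd IH]; [apply Rle_refl|].
  simpl. specialize (H (S d')). lra.
Qed.

Lemma sum_box_mono {k} d d' (F : mindex k -> R) :
  (d <= d')%nat -> (forall a, 0 <= F a) -> sum_box k d F <= sum_box k d' F.
Proof.
  intros Hd; induction k as [|k IH]; simpl; intros H; [apply Rle_refl|].
  eapply Rle_trans; [|apply (sum_mono _ d d' Hd)].
  - apply sum_Rle; intros e _; apply IH; intros; apply H.
  - intros e; apply sum_box_nonneg; intros; apply H.
Qed.

Lemma prod_fin_ext k (F G : Fin.t k -> R) :
  (forall j, F j = G j) -> prod_fin k F = prod_fin k G.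
Proof.
  induction k as [|k IH]; simpl; intros H; [reflexivity|].
  rewrite H; f_equal; apply IH; intros; apply H.
Qed.

Lemma prod_fin_mult k (F G : Fin.t k -> R) :
  prod_fin k (fun j => F j * G j) = prod_fin k F * prod_fin k G.
Proof.
  induction k as [|k IH]; simpl; [ring|]. rewrite IH; ring.
Qed.

Lemma prod_fin_pos k (F : Fin.t k -> R) :
  (forall j, 0 <= F j) -> 0 <= prod_fin k F.
Proof.
  induction k as [|k IH]; simpl; intros H; [lra|].
  apply Rmult_le_pos; auto.
Qed.

Lemma prod_fin_abs_le k (F G : Fin.t k -> R) :
  (forall j, Rabs (F j) <= G j) -> Rabs (prod_fin k F) <= prod_fin k G.
Proof.
  induction k as [|k IH]; simpl; intros H; [rewrite Rabs_R1; lra|].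
  rewrite Rabs_mult. apply Rmult_le_compat; auto using Rabs_pos.
Qed.

Fixpoint sum_fin (k : nat) : (Fin.t k -> nat) -> nat :=
  match k with
  | O => fun _ => 0%nat
  | S k' => fun a => (a Fin.F1 + sum_fin k' (fun j => a (Fin.FS j)))%nat
  end.

Lemma prod_fin_pow k s (a : Fin.t k -> nat) :
  prod_fin k (fun j => s ^ a j) = s ^ sum_fin k a.
Proof.
  induction k as [|k IH]; simpl; [reflexivity|]. rewrite IH, pow_add; reflexivity.
Qed.

(** The product rule along a coordinate line: only the i-th factor moves, so a single summand
    survives. *)
Lemma prod_fin_derivable k (i : Fin.t k) (F : Fin.t k -> R -> R) t l :
  (forall j s, j <> i -> F j s = F j t) -> derivable_pt_lim (F i) t l ->
  derivable_pt_lim (fun s => prod_fin k (fun j => F j s)) t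
    (prod_fin k (fun j => if Fin.eq_dec j i then l else F j t)).
Proof.
  revert F; induction i as [k|k i IH]; intros F Hc Hd.
  - cbn [prod_fin].
    rewrite (prod_fin_ext k (fun j => if Fin.eq_dec (Fin.FS j) Fin.F1 then l else F (Fin.FS j) t)
      (fun j => F (Fin.FS j) t)).
    2:{ intros j. destruct (Fin.eq_dec (Fin.FS j) Fin.F1); [discriminate|reflexivity]. }
    destruct (Fin.eq_dec Fin.F1 Fin.F1) as [_|n]; [|now destruct n].
    apply is_derive_Reals.
    apply is_derive_ext with (fun s => prod_fin k (fun j => F (Fin.FS j) t) * F Fin.F1 s).
    { intros s. rewrite Rmult_comm. apply Rmult_eq_compat_l, prod_fin_ext.
      intros j; symmetry; apply Hc; discriminate. }
    apply is_derive_Reals in Hd.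
    rewrite Rmult_comm. apply (is_derive_scal _ _ _ _ Hd).
  - cbn [prod_fin].
    destruct (Fin.eq_dec Fin.F1 (Fin.FS i)) as [n|_]; [discriminate|].
    rewrite (prod_fin_ext k (fun j => if Fin.eq_dec (Fin.FS j) (Fin.FS i) then l else F (Fin.FS j) t)
      (fun j => if Fin.eq_dec j i then l else F (Fin.FS j) t)).
    2:{ intros j. destruct (Fin.eq_dec (Fin.FS j) (Fin.FS i)) as [e|n], (Fin.eq_dec j i) as [e'|n'];
          auto.
        - apply Fin.FS_inj in e; contradiction.
        - subst; now destruct n. }
    assert (H : derivable_pt_lim (fun s => prod_fin k (fun j => F (Fin.FS j) s)) t
       (prod_fin k (fun j => if Fin.eq_dec j i then l else F (Fin.FS j) t))).
    { apply (IH (fun j => F (Fin.FS j))); [|exact Hd].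
      intros j s Hj. apply Hc. intros e; apply Fin.FS_inj in e; contradiction. }
    apply is_derive_Reals in H. apply is_derive_Reals.
    apply is_derive_ext with (fun s => F Fin.F1 t * prod_fin k (fun j => F (Fin.FS j) s)).
    { intros s. f_equal. symmetry; apply Hc; discriminate. }
    apply (is_derive_scal _ _ _ _ H).
Qed.

(** * Uniform convergence of box sums *)

(** Both [M - T] and [M + T] are nonnegative, so their box sums grow with the box; together the two
    inequalities bound the increment of [T] by that of [M]. *)
Lemma box_tail {m} (T M : mindex m -> R) d d' :
  (d <= d')%nat -> (forall a, Rabs (T a) <= M a) ->
  Rabs (sum_box m d' T - sum_box m d T) <= sum_box m d' M - sum_box m d M.
Proof.
  intros Hd H.
  assert (Hb : forall a, - M a <= T a <= M a) by (intros a; apply Rabs_le_between, H).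
  assert (H1 := sum_box_mono d d' (fun a => M a - T a) Hd ltac:(intros a; specialize (Hb a); lra)).
  assert (H2 := sum_box_mono d d' (fun a => M a + T a) Hd ltac:(intros a; specialize (Hb a); lra)).
  rewrite !sum_box_minus in H1. rewrite !sum_box_plus in H2.
  apply Rabs_le. lra.
Qed.

(* The bound is uniform in T: this is the Weierstrass M-test for box sums. *)
Lemma box_uniform_cauchy {m} (M : mindex m -> R) B :
  (forall a, 0 <= M a) -> (forall d, sum_box m d M <= B) ->
  forall eps, 0 < eps -> exists N, forall T, (forall a, Rabs (T a) <= M a) ->
    forall d d', (N <= d)%nat -> (N <= d')%nat ->
      Rabs (sum_box m d' T - sum_box m d T) < eps.
Proof.
  intros HM HB eps Heps.
  assert (HC : Cauchy_crit (fun d => sum_box m d M)).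
  { apply CV_Cauchy, growing_cv.
    - intros d; apply sum_box_mono; [lia|exact HM].
    - exists B; intros x [d ->]; apply HB. }
  destruct (HC eps Heps) as [N HN]. exists N; intros T HT.
  assert (key : forall d d', (N <= d)%nat -> (d <= d')%nat ->
     Rabs (sum_box m d' T - sum_box m d T) < eps).
  { intros d d' H1 H2. eapply Rle_lt_trans; [apply (box_tail T M); auto|].
    eapply Rle_lt_trans; [apply Rle_abs|]. apply HN; lia. }
  intros d d' H1 H2. destruct (le_ge_dec d d') as [H|H].
  - apply key; auto.
  - rewrite Rabs_minus_sym. apply key; auto.
Qed.

Lemma Un_cv_le_at (u : nat -> R) L x e N :
  Un_cv u L -> (forall d, (N <= d)%nat -> Rabs (u d - x) <= e) -> Rabs (L - x) <= e.
Proof.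
  intros HL H. apply Rnot_lt_le; intros Hlt.
  destruct (HL (Rabs (L - x) - e) ltac:(lra)) as [N' HN'].
  specialize (HN' (max N N') ltac:(lia)). specialize (H (max N N') ltac:(lia)).
  unfold Rdist in HN'.
  assert (Rabs (L - x) <= Rabs (u (max N N') - x) + Rabs (u (max N N') - L)); [|lra].
  replace (L - x) with ((u (max N N') - x) - (u (max N N') - L)) by ring.
  eapply Rle_trans; [apply Rabs_triang|]. rewrite Rabs_Ropp; lra.
Qed.

Lemma box_uniform_limit {m} (M : mindex m -> R) B :
  (forall a, 0 <= M a) -> (forall d, sum_box m d M <= B) ->
  forall eps, 0 < eps -> exists N, forall T L, (forall a, Rabs (T a) <= M a) ->
    Un_cv (fun d => sum_box m d T) L ->
    forall d, (N <= d)%nat -> Rabs (L - sum_box m d T) < eps.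
Proof.
  intros HM HB eps Heps.
  destruct (box_uniform_cauchy M B HM HB (eps / 2) ltac:(lra)) as [N HN].
  exists N; intros T L HT HL d Hd.
  apply Rle_lt_trans with (eps / 2); [|lra].
  apply (Un_cv_le_at _ _ _ _ N HL). intros d' Hd'; left; apply HN; auto.
Qed.

Lemma box_cv {m} (T M : mindex m -> R) B :
  (forall a, Rabs (T a) <= M a) -> (forall d, sum_box m d M <= B) ->
  exists L, Un_cv (fun d => sum_box m d T) L.
Proof.
  intros HT HB.
  assert (HM : forall a, 0 <= M a).
  { intros a; eapply Rle_trans; [apply Rabs_pos|apply HT]. }
  destruct (Rcomplete.R_complete (fun d => sum_box m d T)) as [L HL]; [|exists L; exact HL].
  intros eps Heps. destruct (box_uniform_cauchy M B HM HB eps Heps) as [N HN].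
  exists N; intros d d' H1 H2. apply HN; auto.
Qed.

(** Lets one closure argument for polynomial expressions serve continuity, analyticity in one
    variable and membership in a finitely generated ring. Closure under constants is left to each
    use, since [zring] is only known to contain the integers and its generators. *)
Definition subring {X : Type} (C : (X -> R) -> Prop) : Prop :=
  C (fun _ => 1) /\
  (forall f g, C f -> C g -> C (fun x => f x + g x)) /\
  (forall f g, C f -> C g -> C (fun x => f x * g x)).

Lemma subring_pow {X} (C : (X -> R) -> Prop) f n :
  subring C -> C f -> C (fun x => f x ^ n).
Proof. intros (H0 & H1 & H2) Hf; induction n as [|n IH]; simpl; auto. Qed.

Lemma subring_prod_fin {X} (C : (X -> R) -> Prop) k (F : Fin.t k -> X -> R) :
  subring C -> (forall j, C (F j)) -> C (fun x => prod_fin k (fun j => F j x)).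
Proof.
  intros (H0 & H1 & H2); induction k as [|k IH]; simpl; intros HF; auto.
Qed.

Lemma subring_sum {X} (C : (X -> R) -> Prop) d (F : nat -> X -> R) :
  subring C -> (forall j, (j <= d)%nat -> C (F j)) -> C (fun x => sum_f_R0 (fun j => F j x) d).
Proof.
  intros (H0 & H1 & H2); induction d as [|d IH]; simpl; intros HF; [apply HF; lia|].
  apply H1; [apply IH; intros; apply HF; lia|apply HF; lia].
Qed.

Lemma subring_sum_box {X} (C : (X -> R) -> Prop) k d (F : mindex k -> X -> R) :
  subring C -> (forall a, in_box d a -> C (F a)) -> C (fun x => sum_box k d (fun a => F a x)).
Proof.
  intros HC; induction k as [|k IH]; simpl; intros HF.
  - apply HF. intros j; apply (Fin.case0 (fun j => _ j <= d)%nat j).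
  - apply (subring_sum C d (fun e x => sum_box k d (fun a => F (fin_cons e a) x)) HC).
    intros e He. apply (IH (fun a => F (fin_cons e a))).
    intros a Ha. apply HF, in_box_cons; auto.
Qed.

Lemma subring_mp_eval {X} (C : (X -> R) -> Prop) k (P : mpoly k) (h : Fin.t k -> X -> R) :
  subring C -> (forall c, C (fun _ => c)) -> (forall l, C (h l)) ->
  C (fun x => mp_eval P (fun l => h l x)).
Proof.
  intros HC Hconst Hh; unfold mp_eval.
  apply (subring_sum_box C k (mp_deg P)
    (fun a x => mp_coef P a * prod_fin k (fun j => h j x ^ a j)) HC).
  intros a _. destruct HC as (H0 & H1 & H2). apply H2; auto.
  apply (subring_prod_fin C k (fun j x => h j x ^ a j)); [repeat split; auto|].
  intros j; apply subring_pow; [repeat split; auto|auto].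
Qed.

(** * Continuity at a point, and bounds for differentiated monomials *)

Definition cont_at {m} (g : vec m -> R) (x : vec m) : Prop :=
  forall eps, 0 < eps -> exists delta, 0 < delta /\
    forall y, in_ball x delta y -> Rabs (g y - g x) < eps.

Lemma in_ball_le {m} (x : vec m) r r' y : r <= r' -> in_ball x r y -> in_ball x r' y.
Proof. intros H Hy j; specialize (Hy j); lra. Qed.

Lemma cont_at_const {m} (x : vec m) c : cont_at (fun _ => c) x.
Proof.
  intros eps He. exists 1; split; [lra|]. intros. rewrite Rminus_eq_0, Rabs_R0; auto.
Qed.

Lemma cont_at_subring {m} (x : vec m) : subring (fun g => cont_at g x).
Proof.
  split; [|split].
  - apply cont_at_const.
  - intros f g Hf Hg eps He.
    destruct (Hf (eps / 2) ltac:(lra)) as (d1 & Hd1 & H1).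
    destruct (Hg (eps / 2) ltac:(lra)) as (d2 & Hd2 & H2).
    exists (Rmin d1 d2); split; [apply Rmin_pos; auto|]. intros y Hy.
    specialize (H1 y (in_ball_le _ _ _ _ (Rmin_l _ _) Hy)).
    specialize (H2 y (in_ball_le _ _ _ _ (Rmin_r _ _) Hy)).
    replace (f y + g y - (f x + g x)) with ((f y - f x) + (g y - g x)) by ring.
    eapply Rle_lt_trans; [apply Rabs_triang|]. lra.
  - intros f g Hf Hg eps He.
    (* With both increments below [e] and [e <= 1], the three terms of the product increment add up
       to less than [e * K]; the summand 1 pays for the product of the increments. *)
    set (K := Rabs (f x) + Rabs (g x) + 1).
    assert (HK : 0 < K).
    { assert (Hp1 := Rabs_pos (f x)). assert (Hp2 := Rabs_pos (g x)). unfold K; lra. }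
    set (e := Rmin 1 (eps / K)).
    assert (He' : 0 < e) by (apply Rmin_pos; [lra|apply Rdiv_lt_0_compat; auto]).
    destruct (Hf e He') as (d1 & Hd1 & H1).
    destruct (Hg e He') as (d2 & Hd2 & H2).
    exists (Rmin d1 d2); split; [apply Rmin_pos; auto|]. intros y Hy.
    specialize (H1 y (in_ball_le _ _ _ _ (Rmin_l _ _) Hy)).
    specialize (H2 y (in_ball_le _ _ _ _ (Rmin_r _ _) Hy)).
    replace (f y * g y - f x * g x)
      with ((f y - f x) * (g y - g x) + (f y - f x) * g x + f x * (g y - g x)) by ring.
    apply Rle_lt_trans with (Rabs (f y - f x) * Rabs (g y - g x)
      + Rabs (f y - f x) * Rabs (g x) + Rabs (f x) * Rabs (g y - g x)).
    { rewrite <- !Rabs_mult. eapply Rle_trans; [apply Rabs_triang|].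
      apply Rplus_le_compat_r, Rabs_triang. }
    assert (e <= 1) by apply Rmin_l.
    assert (e * K <= eps).
    { apply Rle_trans with (eps / K * K); [apply Rmult_le_compat_r; [lra|apply Rmin_r]|].
      right; field; lra. }
    assert (Hp1 := Rabs_pos (f x)). assert (Hp2 := Rabs_pos (g x)).
    assert (Hp3 := Rabs_pos (f y - f x)). assert (Hp4 := Rabs_pos (g y - g x)).
    unfold K in *.
    assert (Rabs (f y - f x) * Rabs (g y - g x) < e * 1).
    { apply Rle_lt_trans with (e * Rabs (g y - g x)); [apply Rmult_le_compat_r; lra|].
      apply Rmult_lt_compat_l; lra. }
    assert (Rabs (f y - f x) * Rabs (g x) <= e * Rabs (g x)) by (apply Rmult_le_compat_r; lra).
    assert (Rabs (f x) * Rabs (g y - g x) <= Rabs (f x) * e) by (apply Rmult_le_compat_l; lra).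
    lra.
Qed.

Lemma cont_at_proj {m} (x : vec m) j : cont_at (fun y => y j) x.
Proof. intros eps He; exists eps; split; auto. Qed.

(** The falling factorial e(e-1)...(e-l+1), the coefficient in the l-th derivative of s^e. For l > e
    truncated subtraction supplies a factor 0, which makes the truncated exponent [e - l]
    harmless. *)
Fixpoint fallf (e l : nat) : R :=
  match l with
  | O => 1
  | S l' => fallf e l' * INR (e - l')
  end.

Lemma fallf_pos e l : 0 <= fallf e l.
Proof. induction l as [|l IH]; simpl; [lra|]. apply Rmult_le_pos; auto using pos_INR. Qed.

Lemma fallf_pow_deriv e l s :
  derivable_pt_lim (fun s => fallf e l * s ^ (e - l)) s (fallf e (S l) * s ^ (e - S l)).
Proof.
  simpl. replace (e - S l)%nat with (pred (e - l)) by lia.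
  rewrite Rmult_assoc. apply derivable_pt_lim_scal, derivable_pt_lim_pow.
Qed.

(** The first two terms of the binomial expansion. It gives n r^(n-1) <= (r + delta)^n / delta: a
    derivative is paid for by a slightly larger radius. *)
Lemma bernoulli_pow r delta n :
  0 <= r -> 0 <= delta -> r ^ n + INR n * r ^ pred n * delta <= (r + delta) ^ n.
Proof.
  intros Hr Hd; induction n as [|n IH]; [simpl; lra|].
  replace ((r + delta) ^ S n) with ((r + delta) * (r + delta) ^ n) by reflexivity.
  apply Rle_trans with ((r + delta) * (r ^ n + INR n * r ^ pred n * delta)).
  2: apply Rmult_le_compat_l; lra.
  rewrite S_INR. simpl pred.
  destruct n as [|n]; [simpl; lra|]. simpl pred.
  change (r ^ S (S n)) with (r * (r * r ^ n)). change (r ^ S n) with (r * r ^ n).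
  assert (H1 : 0 <= r ^ n) by (apply pow_le; auto).
  assert (H2 : 0 <= INR (S n) * r ^ n * delta * delta).
  { repeat apply Rmult_le_pos; auto using pos_INR. }
  nra.
Qed.

(** Each differentiation spends half of the remaining gap between [r] and [rho] and divides the
    constant by that half. The constant depends on [l], [r] and [rho] but not on the exponent
    [e]. *)
Lemma fallf_pow_bound l : forall r rho, 0 <= r -> r < rho ->
  exists C, 0 <= C /\ forall e, fallf e l * r ^ (e - l) <= C * rho ^ e.
Proof.
  induction l as [|l IH]; intros r rho Hr Hrho.
  - exists 1; split; [lra|]. intros e; simpl. rewrite Nat.sub_0_r, !Rmult_1_l. apply pow_incr; lra.
  - set (delta := (rho - r) / 2).
    destruct (IH (r + delta) rho) as (C & HC & H); [unfold delta; lra..|].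
    assert (Hd : 0 < delta) by (unfold delta; lra).
    exists (C / delta); split; [apply Rdiv_le_0_compat; auto|].
    intros e. simpl.
    apply Rle_trans with (/ delta * (fallf e l * (r + delta) ^ (e - l))).
    2:{ replace (C / delta * rho ^ e) with (/ delta * (C * rho ^ e)) by (field; lra).
        apply Rmult_le_compat_l; [left; apply Rinv_0_lt_compat; auto|apply H]. }
    replace (e - S l)%nat with (pred (e - l)) by lia.
    replace (fallf e l * INR (e - l) * r ^ pred (e - l))
      with (/ delta * (fallf e l * (INR (e - l) * r ^ pred (e - l) * delta))) by (field; lra).
    apply Rmult_le_compat_l; [left; apply Rinv_0_lt_compat; auto|].
    apply Rmult_le_compat_l; [apply fallf_pos|].
    assert (H1 := bernoulli_pow r delta (e - l) Hr ltac:(lra)).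
    assert (0 <= r ^ (e - l)) by (apply pow_le; auto). lra.
Qed.

(** * Termwise differentiation of power series *)

Definition mono {m} (i : Fin.t m) (l : nat) (j : Fin.t m) (e : nat) (s : R) : R :=
  if Fin.eq_dec j i then fallf e l * s ^ (e - l) else s ^ e.

(* The l-th derivative in the i-th variable of the monomial c_a (y - x0)^a. *)
Definition Dterm {m} (c : mindex m -> R) (x0 : vec m) (i : Fin.t m) (l : nat)
    (a : mindex m) (y : vec m) : R :=
  c a * prod_fin m (fun j => mono i l j (a j) (y j - x0 j)).

(** For rho >= 0, the absolute value of the a-th term at the corner (x0_j + rho)_j of the cube of
    radius rho. *)
Definition majorant {m} (c : mindex m -> R) (rho : R) (a : mindex m) : R :=
  Rabs (c a) * prod_fin m (fun j => rho ^ a j).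

Lemma majorant_pos {m} (c : mindex m -> R) rho a : 0 <= rho -> 0 <= majorant c rho a.
Proof.
  intros H; apply Rmult_le_pos; [apply Rabs_pos|].
  apply prod_fin_pos; intros; apply pow_le; auto.
Qed.

(** Only the i-th factor is differentiated, so only this factor contributes a constant. As [K] is
    chosen before [c], [x0], [a] and [y], the summable majorant of the undifferentiated series also
    controls, uniformly on the smaller cube, the series of every derivative. *)
Lemma Dterm_bound {m} (i : Fin.t m) l r rho : 0 <= r -> r < rho ->
  exists K, 0 <= K /\ forall c x0 a y, (forall j, Rabs (y j - x0 j) <= r) ->
    Rabs (Dterm c x0 i l a y) <= K * majorant c rho a.
Proof.
  intros Hr Hrho. destruct (fallf_pow_bound l r rho Hr Hrho) as (C & HC & H).
  set (q := fun j : Fin.t m => if Fin.eq_dec j i then C else 1).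
  exists (prod_fin m q); split.
  { apply prod_fin_pos; intros j; unfold q; destruct (Fin.eq_dec j i); lra. }
  intros c x0 a y Hy. unfold Dterm, majorant.
  rewrite Rabs_mult.
  replace (prod_fin m q * (Rabs (c a) * prod_fin m (fun j => rho ^ a j)))
    with (Rabs (c a) * prod_fin m (fun j => q j * rho ^ a j)) by (rewrite prod_fin_mult; ring).
  apply Rmult_le_compat_l; [apply Rabs_pos|].
  apply prod_fin_abs_le. intros j; unfold mono, q.
  destruct (Fin.eq_dec j i).
  - rewrite Rabs_mult, (Rabs_pos_eq _ (fallf_pos _ _)), <- RPow_abs.
    eapply Rle_trans; [|apply H].
    apply Rmult_le_compat_l; [apply fallf_pos|]. apply pow_incr; split; [apply Rabs_pos|apply Hy].
  - rewrite <- RPow_abs, Rmult_1_l. apply pow_incr; split; [apply Rabs_pos|].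
    specialize (Hy j); lra.
Qed.

Lemma majorant_sum {m} (c : mindex m -> R) rho B K : 0 <= K ->
  (forall d, sum_box m d (majorant c rho) <= B) ->
  forall d, sum_box m d (fun a => K * majorant c rho a) <= K * B.
Proof. intros HK H d. rewrite sum_box_scal. apply Rmult_le_compat_l; auto. Qed.

Lemma upd_same {m} (y : vec m) i t : upd y i t i = t.
Proof. unfold upd; destruct (Fin.eq_dec i i); [reflexivity|contradiction]. Qed.

Lemma upd_id {m} (y : vec m) i : upd y i (y i) = y.
Proof.
  apply functional_extensionality; intro j; unfold upd.
  destruct (Fin.eq_dec j i); subst; reflexivity.
Qed.

Lemma upd_upd {m} (y : vec m) i s t : upd (upd y i s) i t = upd y i t.
Proof.
  apply functional_extensionality; intro j; unfold upd.
  destruct (Fin.eq_dec j i); reflexivity.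
Qed.

Lemma in_ball_upd {m} (x y : vec m) r i t :
  in_ball x r y -> Rabs (t - x i) < r -> in_ball x r (upd y i t).
Proof.
  intros Hy Ht j; unfold upd. destruct (Fin.eq_dec j i); subst; auto.
Qed.

Lemma Dterm_derivable {m} c (x0 : vec m) i l a y t :
  derivable_pt_lim (fun s => Dterm c x0 i l a (upd y i s)) t (Dterm c x0 i (S l) a (upd y i t)).
Proof.
  unfold Dterm. apply derivable_pt_lim_scal.
  rewrite (prod_fin_ext m (fun j => mono i (S l) j (a j) (upd y i t j - x0 j))
    (fun j => if Fin.eq_dec j i then fallf (a i) (S l) * (t - x0 i) ^ (a i - S l)
              else mono i l j (a j) (upd y i t j - x0 j))).
  - apply (prod_fin_derivable m i (fun j s => mono i l j (a j) (upd y i s j - x0 j))).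
    + intros j s Hj; unfold upd; destruct (Fin.eq_dec j i); [contradiction|reflexivity].
    + apply is_derive_Reals.
      apply is_derive_ext with (fun s => fallf (a i) l * (s - x0 i) ^ (a i - l)).
      { intros s. unfold mono. rewrite upd_same.
        destruct (Fin.eq_dec i i); [reflexivity|contradiction]. }
      apply is_derive_Reals.
      rewrite <- (Rmult_1_r (fallf (a i) (S l) * (t - x0 i) ^ (a i - S l))).
      apply (derivable_pt_lim_comp (fun s => s - x0 i) (fun s => fallf (a i) l * s ^ (a i - l))).
      * rewrite <- (Rminus_0_r 1). apply derivable_pt_lim_minus;
          [apply derivable_pt_lim_id|apply derivable_pt_lim_const].
      * apply fallf_pow_deriv.
  - intros j; unfold mono. destruct (Fin.eq_dec j i); [subst; rewrite upd_same|]; reflexivity.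
Qed.

Lemma sum_derivable d (F G : nat -> R -> R) t :
  (forall e, (e <= d)%nat -> derivable_pt_lim (F e) t (G e t)) ->
  derivable_pt_lim (fun s => sum_f_R0 (fun e => F e s) d) t (sum_f_R0 (fun e => G e t) d).
Proof.
  intros H; induction d as [|d IH]; simpl; [apply H; lia|].
  apply (derivable_pt_lim_plus (fun s => sum_f_R0 (fun e => F e s) d)); auto.
Qed.

Lemma sum_box_derivable k d (F G : mindex k -> R -> R) t :
  (forall a, derivable_pt_lim (F a) t (G a t)) ->
  derivable_pt_lim (fun s => sum_box k d (fun a => F a s)) t (sum_box k d (fun a => G a t)).
Proof.
  induction k as [|k IH]; simpl; intros H; [apply H|].
  apply (sum_derivable d (fun e s => sum_box k d (fun a => F (fin_cons e a) s))
    (fun e s => sum_box k d (fun a => G (fin_cons e a) s))).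
  intros e _; apply (IH (fun a => F (fin_cons e a)) (fun a => G (fin_cons e a))); auto.
Qed.

Lemma pderiv_unique {m} (i : Fin.t m) g x l :
  derivable_pt_lim (fun t => g (upd x i t)) (x i) l -> pderiv i g x = l.
Proof.
  intros H. unfold pderiv.
  assert (E := epsilon_spec (inhabits 0)
    (fun l => derivable_pt_lim (fun t => g (upd x i t)) (x i) l) (ex_intro _ l H)).
  simpl in E. eapply uniqueness_limite; eauto.
Qed.

(** The induction step from order l to l+1: the differentiated series converges uniformly, so its
    sum is the derivative. The radius [r] does not shrink with l, because the bounds always go back
    to the same majorant at [rho]. *)
Lemma termwise_pderiv {m} (i : Fin.t m) l h c x0 r rho B :
  0 < r < rho ->
  (forall d, sum_box m d (majorant c rho) <= B) ->
  (forall y, in_ball x0 r y -> Un_cv (fun d => sum_box m d (fun a => Dterm c x0 i l a y)) (h y)) ->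
  forall y, in_ball x0 r y ->
    Un_cv (fun d => sum_box m d (fun a => Dterm c x0 i (S l) a y)) (pderiv i h y) /\
    derivable_pt_lim (fun t => h (upd y i t)) (y i) (pderiv i h y).
Proof.
  intros Hr HB Hh y Hy.
  destruct (Dterm_bound i (S l) r rho) as (K & HK & HT); [lra..|].
  assert (HT' : forall y a, in_ball x0 r y ->
            Rabs (Dterm c x0 i (S l) a y) <= K * majorant c rho a).
  { intros z a Hz; apply HT; intros j; left; apply Hz. }
  set (psi := fun z => epsilon (inhabits 0)
     (fun L => Un_cv (fun d => sum_box m d (fun a => Dterm c x0 i (S l) a z)) L)).
  assert (Hpsi : forall z, in_ball x0 r z ->
      Un_cv (fun d => sum_box m d (fun a => Dterm c x0 i (S l) a z)) (psi z)).
  { intros z Hz. unfold psi. apply epsilon_spec.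
    apply (box_cv _ (fun a => K * majorant c rho a) (K * B)); [auto|].
    apply majorant_sum; auto. }
  assert (Hd : derivable_pt_lim (fun t => h (upd y i t)) (y i) (psi y)).
  { set (rr := mkposreal r (proj1 Hr)).
    (* The interval of uniform convergence is centred at [x0 i], not at [y i]: the points
       [upd y i t] in the cube are exactly those with t within [r] of [x0 i]. *)
    assert (HU : CVU (fun d t => sum_box m d (fun a => Dterm c x0 i (S l) a (upd y i t)))
                     (fun t => psi (upd y i t)) (x0 i) rr).
    { intros eps Heps.
      destruct (box_uniform_limit (fun a => K * majorant c rho a) (K * B)) with (eps := eps)
        as [N HN]; auto.
      - intros a; apply Rmult_le_pos; auto; apply majorant_pos; lra.
      - apply majorant_sum; auto.
      - exists N; intros d t Hd Ht.
        assert (Hb : in_ball x0 r (upd y i t)) by (apply in_ball_upd; auto).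
        apply (HN (fun a => Dterm c x0 i (S l) a (upd y i t))); auto. }
    assert (E : psi y = psi (upd y i (y i))) by (rewrite upd_id; reflexivity).
    rewrite E.
    apply (derivable_pt_lim_CVU
      (fun d t => sum_box m d (fun a => Dterm c x0 i l a (upd y i t)))
      (fun d t => sum_box m d (fun a => Dterm c x0 i (S l) a (upd y i t)))
      (fun t => h (upd y i t)) (fun t => psi (upd y i t)) (y i) (x0 i) rr).
    - apply Hy.
    - intros t d _.
      apply (sum_box_derivable m d (fun a t => Dterm c x0 i l a (upd y i t))
         (fun a t => Dterm c x0 i (S l) a (upd y i t))).
      intros a; apply Dterm_derivable.
    - intros t Ht; apply Hh, in_ball_upd; auto.
    - exact HU.
    (* Continuity passes from the partial sums to the limit; the partial sums are continuous because
       they can be differentiated once more. *)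
    - apply (CVU_continuity _ _ _ _ HU). intros d t _.
      apply derivable_continuous_pt.
      exists (sum_box m d (fun a => Dterm c x0 i (S (S l)) a (upd y i t))).
      apply (sum_box_derivable m d (fun a t => Dterm c x0 i (S l) a (upd y i t))
         (fun a t => Dterm c x0 i (S (S l)) a (upd y i t))).
      intros a; apply Dterm_derivable. }
  rewrite (pderiv_unique i h y (psi y) Hd). split; auto.
Qed.

(** One choice of coefficients, radii and bound for all orders [l] at once. The existence of the
    derivatives is recorded too, since the value of [pderivn] alone does not show it. *)
Definition local_expansion {m} (dom : vec m -> Prop) (g : vec m -> R) (i : Fin.t m)
    (x0 : vec m) (c : mindex m -> R) (r rho B : R) : Prop :=
  0 < r < rho /\
  (forall d, sum_box m d (majorant c rho) <= B) /\
  (forall y, in_ball x0 r y -> dom y) /\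
  forall l y, in_ball x0 r y ->
    Un_cv (fun d => sum_box m d (fun a => Dterm c x0 i l a y)) (pderivn i l g y) /\
    derivable_pt_lim (fun t => pderivn i l g (upd y i t)) (y i) (pderivn i (S l) g y).

Lemma analytic_local_expansion {m} dom g (i : Fin.t m) x0 :
  analytic_at dom g x0 -> exists c r rho B, local_expansion dom g i x0 c r rho B.
Proof.
  intros (R0 & c & HR & H).
  (* Absolute convergence at this one corner is the summability of the majorant at R0/2; the cube of
     radius R0/4 then leaves the gap needed for differentiation. *)
  assert (Hrho : in_ball x0 R0 (fun j => x0 j + R0 / 2)).
  { intros j. replace (x0 j + R0 / 2 - x0 j) with (R0 / 2) by ring. rewrite Rabs_pos_eq; lra. }
  destruct (H _ Hrho) as (_ & [B HB] & _).
  assert (HB' : forall d, sum_box m d (majorant c (R0 / 2)) <= B).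
  { intros d; rewrite <- (HB d). apply Req_le, sum_box_ext. intros a _.
    rewrite Rabs_mult. unfold majorant. f_equal.
    rewrite Rabs_pos_eq.
    - apply prod_fin_ext; intros j. f_equal. ring.
    - apply prod_fin_pos; intros j; apply pow_le.
      replace (x0 j + R0 / 2 - x0 j) with (R0 / 2) by ring. lra. }
  assert (Hr : 0 < R0 / 4 < R0 / 2) by lra.
  assert (H0 : forall y, in_ball x0 (R0 / 4) y ->
     Un_cv (fun d => sum_box m d (fun a => Dterm c x0 i 0 a y)) (g y)).
  { intros y Hy. destruct (H y (in_ball_le _ (R0 / 4) R0 _ ltac:(lra) Hy)) as (_ & _ & Hc).
    eapply Un_cv_ext; [|exact Hc]. intros d. apply sum_box_ext; intros a _.
    unfold Dterm. f_equal. apply prod_fin_ext; intros j; unfold mono.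
    destruct (Fin.eq_dec j i); [|reflexivity]. simpl. rewrite Nat.sub_0_r; ring. }
  exists c, (R0 / 4), (R0 / 2), B. split; [exact Hr|]. split; [exact HB'|]. split.
  { intros y Hy. apply (H y), (in_ball_le _ (R0 / 4)); [lra|auto]. }
  assert (Hl : forall l y, in_ball x0 (R0 / 4) y ->
    Un_cv (fun d => sum_box m d (fun a => Dterm c x0 i l a y)) (pderivn i l g y)).
  { induction l as [|l IH]; [exact H0|].
    intros y Hy. apply (termwise_pderiv i l _ c x0 _ _ B Hr HB' IH y Hy). }
  intros l y Hy; split; auto.
  apply (termwise_pderiv i l _ c x0 _ _ B Hr HB' (Hl l) y Hy).
Qed.

(** A uniform limit of polynomials is continuous: a partial sum is within eps/3 on the whole cube,
    and it varies by less than eps/3 near [x0]. *)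
Lemma pderivn_cont {m} dom g (i : Fin.t m) x0 l :
  analytic_at dom g x0 -> cont_at (pderivn i l g) x0.
Proof.
  intros Ha. destruct (analytic_local_expansion dom g i x0 Ha) as (c & r & rho & B & Hr & HB & _ & H).
  intros eps Heps.
  destruct (Dterm_bound i l r rho) as (K & HK & HT); [lra..|].
  destruct (box_uniform_limit (fun a => K * majorant c rho a) (K * B)) with (eps := eps / 3)
    as [N HN]; [|apply majorant_sum; auto|lra|].
  { intros a; apply Rmult_le_pos; auto; apply majorant_pos; lra. }
  assert (HN' : forall y, in_ball x0 r y ->
    Rabs (pderivn i l g y - sum_box m N (fun a => Dterm c x0 i l a y)) < eps / 3).
  { intros y Hy. apply (HN (fun a => Dterm c x0 i l a y)); auto.
    - intros a; apply HT. intros j; left; apply Hy.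
    - apply H; auto. }
  assert (Hc : cont_at (fun y => sum_box m N (fun a => Dterm c x0 i l a y)) x0).
  { assert (Hs := cont_at_subring x0). assert (Hs' := Hs). destruct Hs' as (_ & Hs2 & Hs3).
    apply (subring_sum_box _ m N (fun a y => Dterm c x0 i l a y) Hs).
    intros a _. apply Hs3; [apply cont_at_const|].
    apply (subring_prod_fin _ m (fun j y => mono i l j (a j) (y j - x0 j)) Hs).
    intros j.
    assert (Hp : forall n, cont_at (fun y : vec m => (y j - x0 j) ^ n) x0).
    { intros n. apply (subring_pow _ (fun y : vec m => y j - x0 j) n Hs).
      apply Hs2; [apply cont_at_proj|apply cont_at_const]. }
    unfold mono. destruct (Fin.eq_dec j i); [|apply Hp].
    apply Hs3; [apply cont_at_const|apply Hp]. }
  destruct (Hc (eps / 3) ltac:(lra)) as (delta & Hd & Hdelta).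
  exists (Rmin delta r); split; [apply Rmin_pos; lra|].
  intros y Hy.
  assert (H1 := HN' y (in_ball_le _ _ _ _ (Rmin_r _ _) Hy)).
  assert (H2 := Hdelta y (in_ball_le _ _ _ _ (Rmin_l _ _) Hy)).
  assert (H3 := HN' x0 ltac:(intros j; rewrite Rminus_eq_0, Rabs_R0; lra)).
  simpl in H2.
  apply Rabs_def2 in H1, H2, H3. apply Rabs_def1; lra.
Qed.

Lemma pderivn_derivable {m} dom g (i : Fin.t m) x0 l :
  analytic_at dom g x0 ->
  derivable_pt_lim (fun t => pderivn i l g (upd x0 i t)) (x0 i) (pderivn i (S l) g x0).
Proof.
  intros Ha. destruct (analytic_local_expansion dom g i x0 Ha) as (c & r & rho & B & Hr & _ & _ & H).
  apply H. intros j; rewrite Rminus_eq_0, Rabs_R0; lra.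
Qed.

(** * Restriction to lines and analytic continuation *)

Lemma choice_fun {A B : Type} (Q : A -> B -> Prop) :
  (forall x, exists y, Q x y) -> exists f, forall x, Q x (f x).
Proof.
  intros H. exists (fun x => proj1_sig (constructive_indefinite_description _ (H x))).
  intros x. apply (proj2_sig (constructive_indefinite_description _ (H x))).
Qed.

Lemma Un_cv_const x : Un_cv (fun _ => x) x.
Proof. intros eps He; exists 0%nat; intros. unfold Rdist. rewrite Rminus_eq_0, Rabs_R0; auto. Qed.

(** Absolute convergence at [rho] permits collecting the terms with the same exponent [p a = e] into
    one coefficient [b e]. That coefficient is itself a limit of box sums, dominated by the majorant
    divided by rho^e. *)
Lemma box_regroup {m} (gam : mindex m -> R) (p : mindex m -> nat) rho B (phi : R -> R) :
  0 < rho ->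
  (forall d, sum_box m d (fun a => Rabs (gam a) * rho ^ p a) <= B) ->
  (forall s, Rabs s < rho -> Un_cv (fun d => sum_box m d (fun a => gam a * s ^ p a)) (phi s)) ->
  exists b, forall s, Rabs s < rho -> is_pseries b s (phi s).
Proof.
  intros Hrho HB Hphi.
  set (M := fun a => Rabs (gam a) * rho ^ p a) in *.
  assert (HM : forall a, 0 <= M a).
  { intros a; apply Rmult_le_pos; [apply Rabs_pos|apply pow_le; lra]. }
  destruct (choice_fun (fun (e : nat) L =>
     Un_cv (fun d => sum_box m d (fun a => if p a =? e then gam a else 0)) L)) as [b Hb].
  { intros e. apply (box_cv _ (fun a => / rho ^ e * M a) (/ rho ^ e * B)).
    - assert (He : 0 < rho ^ e) by (apply pow_lt; auto).
      assert (He' := Rinv_0_lt_compat _ He).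
      intros a. destruct (Nat.eqb_spec (p a) e) as [<-|_].
      + unfold M. right; field; lra.
      + rewrite Rabs_R0. apply Rmult_le_pos; [lra|apply HM].
    - intros d; rewrite sum_box_scal. apply Rmult_le_compat_l; [|apply HB].
      left; apply Rinv_0_lt_compat, pow_lt; auto. }
  exists b; intros s Hs.
  assert (Hpart : forall E, Un_cv
     (fun d => sum_box m d (fun a => if p a <=? E then gam a * s ^ p a else 0))
     (sum_f_R0 (fun e => b e * s ^ e) E)).
  { assert (Hone : forall e, Un_cv
       (fun d => sum_box m d (fun a => if p a =? e then gam a * s ^ p a else 0)) (b e * s ^ e)).
    { intros e. eapply Un_cv_ext; [|apply CV_mult; [apply Hb|apply (Un_cv_const (s ^ e))]].
      intros d. simpl. rewrite Rmult_comm, <- sum_box_scal. apply sum_box_ext; intros a _.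
      destruct (Nat.eqb_spec (p a) e) as [<-|_]; ring. }
    induction E as [|E IH].
    - simpl. eapply Un_cv_ext; [|apply (Hone 0%nat)].
      intros d; apply sum_box_ext; intros a _.
      destruct (Nat.eqb_spec (p a) 0), (Nat.leb_spec (p a) 0); auto; lia.
    - simpl. eapply Un_cv_ext; [|apply CV_plus; [apply IH|apply (Hone (S E))]].
      intros d. simpl. rewrite <- sum_box_plus. apply sum_box_ext; intros a _.
      destruct (Nat.eqb_spec (p a) (S E)), (Nat.leb_spec (p a) E), (Nat.leb_spec (p a) (S E));
        try lia; try ring. }
  (* A term of exponent above E is at most q^E times its majorant, so the regrouped partial sum
     differs from [phi s] by at most q^E B, with q < 1. *)
  set (q := Rabs s / rho).
  assert (Hq : 0 <= q < 1).
  { split; [apply Rdiv_le_0_compat; [apply Rabs_pos|auto]|].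
    apply Rlt_div_l; auto; lra. }
  assert (HB0 : 0 <= B) by (apply Rle_trans with (2 := HB 0%nat), sum_box_nonneg, HM).
  assert (Htail : forall E, Rabs (phi s - sum_f_R0 (fun e => b e * s ^ e) E) <= q ^ E * B).
  { intros E. rewrite <- (Rminus_0_r (phi s - _)).
    apply (Un_cv_le_at _ _ _ _ 0 (CV_minus _ _ _ _ (Hphi s Hs) (Hpart E))).
    intros d _. rewrite Rminus_0_r, <- sum_box_minus.
    eapply Rle_trans; [apply sum_box_abs|].
    apply Rle_trans with (sum_box m d (fun a => q ^ E * M a)).
    2:{ rewrite sum_box_scal. apply Rmult_le_compat_l; [apply pow_le; lra|apply HB]. }
    apply sum_box_le; intros a.
    destruct (Nat.leb_spec (p a) E) as [_|H].
    - rewrite Rminus_eq_0, Rabs_R0. apply Rmult_le_pos; [apply pow_le; lra|apply HM].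
    - rewrite Rminus_0_r, Rabs_mult, <- RPow_abs.
      replace (Rabs s) with (q * rho) by (unfold q; field; lra).
      rewrite Rpow_mult_distr. unfold M.
      replace (Rabs (gam a) * (q ^ p a * rho ^ p a)) with (q ^ p a * (Rabs (gam a) * rho ^ p a)) by ring.
      apply Rmult_le_compat_r; [apply HM|].
      replace (p a) with (E + (p a - E))%nat by lia. rewrite pow_add.
      rewrite <- (Rmult_1_r (q ^ E)) at 2. apply Rmult_le_compat_l; [apply pow_le; lra|].
      rewrite <- (pow1 (p a - E)). apply pow_incr; lra. }
  apply is_pseries_R, is_series_Reals.
  intros eps Heps.
  (* Dividing by [B + 1] covers the case B = 0. *)
  destruct (pow_lt_1_zero q ltac:(rewrite Rabs_pos_eq; lra) (eps / (B + 1))) as [N HN].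
  { apply Rdiv_lt_0_compat; lra. }
  exists N; intros E HE. specialize (HN E HE). unfold Rdist.
  rewrite Rabs_minus_sym. eapply Rle_lt_trans; [apply Htail|].
  rewrite Rabs_pos_eq in HN by (apply pow_le; lra).
  apply Rle_lt_trans with (q ^ E * (B + 1)).
  { apply Rmult_le_compat_l; [apply pow_le; lra|lra]. }
  apply Rmult_lt_reg_r with (/ (B + 1)); [apply Rinv_0_lt_compat; lra|].
  rewrite Rmult_assoc, Rinv_r by lra. rewrite Rmult_1_r. exact HN.
Qed.

(** * Analytic functions of one real variable and the identity theorem *)

Definition analytic1 (phi : R -> R) (t0 : R) : Prop :=
  exists b r, 0 < r /\ forall s, Rabs s < r -> is_pseries b s (phi (t0 + s)).

(** A radius of at most |s| would be smaller than a point u strictly between |s| and r; the series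
    would then diverge at u, although it converges there. Products and continuity of power series
    need this strict inequality. *)
Lemma pseries_radius b r (L : R -> R) s :
  (forall s, Rabs s < r -> is_pseries b s (L s)) -> Rabs s < r ->
  Rbar_lt (Rabs s) (CV_radius b).
Proof.
  intros H Hs. apply Rbar_not_le_lt; intros Hle.
  set (u := (Rabs s + r) / 2).
  assert (Hu : Rabs s < u < r) by (unfold u; lra).
  assert (Hu0 : Rabs u = u) by (apply Rabs_pos_eq; assert (H0 := Rabs_pos s); lra).
  apply (CV_disk_outside b u).
  - eapply Rbar_le_lt_trans; [exact Hle|]. simpl. lra.
  - apply ex_series_lim_0. exists (L u). apply is_pseries_R, H. lra.
Qed.

Lemma analytic1_const c t0 : analytic1 (fun _ => c) t0.
Proof.
  exists (fun n => match n with O => c | _ => 0 end), 1. split; [lra|].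
  intros s _. apply is_pseries_R, is_series_Reals.
  intros eps He; exists 0%nat; intros n _.
  replace (sum_f_R0 _ n) with c; [unfold Rdist; rewrite Rminus_eq_0, Rabs_R0; auto|].
  induction n as [|n IH]; simpl; [ring|]. rewrite <- IH; ring.
Qed.

Lemma analytic1_subring t0 : subring (fun phi => analytic1 phi t0).
Proof.
  split; [|split].
  - apply analytic1_const.
  - intros f g (b & r & Hr & H) (b' & r' & Hr' & H').
    exists (PS_plus b b'), (Rmin r r'). split; [apply Rmin_pos; auto|].
    intros s Hs. assert (H1 := Rmin_l r r'). assert (H2 := Rmin_r r r').
    apply (is_pseries_plus b b' s); [apply H|apply H']; lra.
  - intros f g (b & r & Hr & H) (b' & r' & Hr' & H').
    exists (PS_mult b b'), (Rmin r r'). split; [apply Rmin_pos; auto|].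
    intros s Hs. assert (H1 := Rmin_l r r'). assert (H2 := Rmin_r r r').
    apply is_pseries_mult; [apply H; lra|apply H'; lra|..].
    + apply (pseries_radius _ r (fun s => f (t0 + s))); [auto|lra].
    + apply (pseries_radius _ r' (fun s => g (t0 + s))); [auto|lra].
Qed.

(** By strong induction every coefficient vanishes: if all before the n-th do, phi(t0 + s) = s^n
    a(s) with [a] continuous and a(0) = b n, and the zeros accumulating at t0 force a(0) = 0. *)
Lemma analytic1_isolated_zeros phi t0 :
  analytic1 phi t0 ->
  (forall eps, 0 < eps -> exists s, 0 < Rabs s < eps /\ phi (t0 + s) = 0) ->
  exists r, 0 < r /\ forall s, Rabs s < r -> phi (t0 + s) = 0.
Proof.
  intros (b & r & Hr & H) Hz.
  assert (Hb : forall n, b n = 0).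
  { induction n as [n IH] using lt_wf_ind.
    apply NNPP; intros Hn.
    set (a := PS_decr_n b n).
    assert (Ha : forall s, Rabs s < r -> is_pseries a s (PSeries a s)).
    { intros s Hs. apply PSeries_correct. apply ex_pseries_decr_n.
      - destruct (Req_dec s 0) as [->|Hs0]; [left; reflexivity|right].
        exists (/ s). apply Rinv_l; auto.
      - eexists; apply H; auto. }
    assert (Hc : continuity_pt (PSeries a) 0).
    { apply PSeries_continuity, (pseries_radius _ r _ _ Ha). rewrite Rabs_R0; auto. }
    assert (Ha0 : PSeries a 0 = b n).
    { rewrite PSeries_0. unfold a, PS_decr_n. rewrite Nat.add_0_r; reflexivity. }
    destruct (Hc (Rabs (b n)) (Rabs_pos_lt _ Hn)) as (delta & Hd & Hdelta).
    destruct (Hz (Rmin delta r)) as (s & Hs & Hs0); [apply Rmin_pos; auto|].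
    assert (H1 := Rmin_l delta r). assert (H2 := Rmin_r delta r).
    assert (Hps : PSeries a s = 0).
    { assert (E := is_pseries_unique _ _ _ (H s ltac:(lra))).
      rewrite (PSeries_decr_n_aux b n s IH), Hs0 in E.
      apply Rmult_integral in E; destruct E as [E|E]; auto.
      exfalso; apply (pow_nonzero s n); auto.
      intros ->; rewrite Rabs_R0 in Hs; lra. }
    assert (Hlt : Rabs (PSeries a s - PSeries a 0) < Rabs (b n)).
    { apply Hdelta. split.
      - split; [exact I|]. intros <-; rewrite Rabs_R0 in Hs; lra.
      - simpl; unfold Rdist. rewrite Rminus_0_r; lra. }
    rewrite Hps, Ha0, Rminus_0_l, Rabs_Ropp in Hlt. lra. }
  exists r; split; auto. intros s Hs.
  rewrite <- (is_pseries_unique _ _ _ (H s Hs)).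
  rewrite (PSeries_ext b (fun _ => 0)) by auto. apply PSeries_const_0.
Qed.

(** Let T be the supremum of those T' for which phi vanishes on [0,T'). Zeros accumulate at T from
    the left, so phi vanishes around T; this settles T = 1 and contradicts maximality if T < 1. *)
Lemma analytic1_zero phi delta :
  (forall t, 0 <= t <= 1 -> analytic1 phi t) -> 0 < delta ->
  (forall t, 0 <= t < delta -> phi t = 0) -> phi 1 = 0.
Proof.
  intros Ha Hd H0.
  set (E := fun T => 0 <= T <= 1 /\ forall t, 0 <= t < T -> phi t = 0).
  assert (H1 := Rmin_l delta 1). assert (H2 := Rmin_r delta 1).
  assert (H3 := Rmin_pos delta 1 Hd Rlt_0_1).
  assert (HE0 : E (Rmin delta 1)).
  { split; [lra|]. intros t Ht; apply H0; lra. }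
  destruct (completeness E) as [T [HT1 HT2]].
  { exists 1; intros T [HT _]; lra. }
  { eexists; exact HE0. }
  assert (HT : 0 < T <= 1).
  { split; [specialize (HT1 _ HE0); lra|]. apply HT2; intros x [Hx _]; lra. }
  assert (Hz : forall t, 0 <= t < T -> phi t = 0).
  { intros t Ht. apply NNPP; intros Hn.
    apply (Rlt_not_le T t); [lra|]. apply HT2. intros x [Hx Hx'].
    apply Rnot_lt_le; intros Hlt. apply Hn, Hx'; lra. }
  destruct (analytic1_isolated_zeros phi T) as (r & Hr & HrT).
  { apply Ha; lra. }
  (* A step to the left of T, cut off at T so as not to pass below 0. *)
  { intros eps He. exists (- Rmin (eps / 2) T).
    assert (0 < Rmin (eps / 2) T) by (apply Rmin_pos; lra).
    assert (Rmin (eps / 2) T <= eps / 2) by apply Rmin_l.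
    assert (Rmin (eps / 2) T <= T) by apply Rmin_r.
    rewrite Rabs_Ropp, Rabs_pos_eq by lra. split; [lra|]. apply Hz; lra. }
  destruct (Req_dec T 1) as [->|HT'].
  { rewrite <- (Rplus_0_r 1). apply HrT. rewrite Rabs_R0; auto. }
  exfalso.
  set (e := Rmin (r / 2) (1 - T)).
  assert (He : 0 < e) by (apply Rmin_pos; lra).
  assert (He1 : e <= r / 2) by apply Rmin_l.
  assert (He2 : e <= 1 - T) by apply Rmin_r.
  assert (HE : E (T + e)).
  { split; [lra|]. intros t Ht. destruct (Rlt_le_dec t T); [apply Hz; lra|].
    replace t with (T + (t - T)) by ring. apply HrT. rewrite Rabs_pos_eq; lra. }
  specialize (HT1 _ HE). lra.
Qed.

Lemma fin_uniform {k} (Q : Fin.t k -> R -> Prop) :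
  (forall j e e', 0 < e' <= e -> Q j e -> Q j e') ->
  (forall j, exists e, 0 < e /\ Q j e) -> exists e, 0 < e /\ forall j, Q j e.
Proof.
  intros Hm H. induction k as [|k IH].
  - exists 1; split; [lra|]. intros j; apply (Fin.case0 (fun j => Q j 1) j).
  - destruct (IH (fun j => Q (Fin.FS j))) as (e & He & HQ); eauto.
    destruct (H Fin.F1) as (e' & He' & HQ').
    assert (H1 := Rmin_l e e'). assert (H2 := Rmin_r e e').
    assert (H3 := Rmin_pos e e' He He').
    exists (Rmin e e'); split; auto. apply fin_caseS; [eapply Hm; [|apply HQ']; lra|].
    intros j; eapply Hm; [|apply HQ]; lra.
Qed.

Lemma scale_small {m} (v : vec m) r : 0 < r ->
  exists sig, 0 < sig /\ forall j, sig * Rabs (v j) < r.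
Proof.
  intros Hr. apply (fin_uniform (fun j e => e * Rabs (v j) < r)).
  - intros j e e' He HQ. eapply Rle_lt_trans; [|exact HQ].
    apply Rmult_le_compat_r; [apply Rabs_pos|lra].
  - intros j. exists (r / (Rabs (v j) + 1)).
    assert (Hp := Rabs_pos (v j)).
    split; [apply Rdiv_lt_0_compat; lra|].
    apply Rlt_le_trans with (r / (Rabs (v j) + 1) * (Rabs (v j) + 1)).
    + apply Rmult_lt_compat_l; [apply Rdiv_lt_0_compat; lra|lra].
    + right; field; lra.
Qed.

Definition line {m} (p v : vec m) (t : R) : vec m := fun j => p j + t * v j.

Lemma line_in_ball {m} (p v : vec m) t0 r : 0 < r ->
  exists e, 0 < e /\ forall t, Rabs (t - t0) < e -> in_ball (line p v t0) r (line p v t).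
Proof.
  intros Hr. destruct (scale_small v r Hr) as (e & He & Hv).
  exists e; split; auto. intros t Ht j.
  replace (line p v t j - line p v t0 j) with ((t - t0) * v j) by (unfold line; ring).
  rewrite Rabs_mult. eapply Rle_lt_trans; [|apply (Hv j)].
  apply Rmult_le_compat_r; [apply Rabs_pos|lra].
Qed.

(** At parameter t0 + s a term of the expansion is a constant times s to its total degree after l
    differentiations. Choosing [sig] so that the displacement sig v stays inside the cube makes the
    series absolutely convergent there, and regrouping gives a power series in s. *)
Lemma pderivn_line_analytic {m} dom g (i : Fin.t m) l p v t0 :
  analytic_at dom g (line p v t0) ->
  analytic1 (fun t => pderivn i l g (line p v t)) t0.
Proof.
  intros Ha. set (x0 := line p v t0) in *.
  destruct (analytic_local_expansion dom g i x0 Ha) as (c & r & rho & B & Hr & HB & _ & H).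
  destruct (Dterm_bound i l r rho) as (K & HK & HT); [lra..|].
  destruct (scale_small v r (proj1 Hr)) as (sig & Hsig & Hv).
  set (gam := fun a => c a * prod_fin m (fun j => mono i l j (a j) (v j))).
  set (p' := fun a : mindex m => sum_fin m (fun j => if Fin.eq_dec j i then a j - l else a j)%nat).
  assert (Hsplit : forall a s, Dterm c x0 i l a (line p v (t0 + s)) = gam a * s ^ p' a).
  { intros a s. unfold Dterm, gam, p'. rewrite <- prod_fin_pow, Rmult_assoc, <- prod_fin_mult.
    f_equal. apply prod_fin_ext; intros j.
    replace (line p v (t0 + s) j - x0 j) with (v j * s) by (unfold x0, line; ring).
    unfold mono. destruct (Fin.eq_dec j i); rewrite Rpow_mult_distr; ring. }
  assert (Hb : forall s, Rabs s < sig -> in_ball x0 r (line p v (t0 + s))).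
  { intros s Hs j. replace (line p v (t0 + s) j - x0 j) with (s * v j) by (unfold x0, line; ring).
    rewrite Rabs_mult. eapply Rle_lt_trans; [|apply (Hv j)].
    apply Rmult_le_compat_r; [apply Rabs_pos|lra]. }
  destruct (box_regroup gam p' sig (K * B) (fun s => pderivn i l g (line p v (t0 + s))))
    as [b Hbs]; auto.
  - intros d. eapply Rle_trans; [|apply (majorant_sum c rho B K HK HB d)].
    apply sum_box_le; intros a.
    replace (Rabs (gam a) * sig ^ p' a) with (Rabs (Dterm c x0 i l a (line p v (t0 + sig)))).
    + apply HT; intros j.
      replace (line p v (t0 + sig) j - x0 j) with (sig * v j) by (unfold x0, line; ring).
      rewrite Rabs_mult, (Rabs_pos_eq sig) by lra. left; apply Hv.
    + rewrite Hsplit, Rabs_mult. f_equal. apply Rabs_pos_eq, pow_le; lra.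
  - intros s Hs. eapply Un_cv_ext; [|apply (H l _ (Hb s Hs))].
    intros d; apply sum_box_ext; intros a _; apply Hsplit.
  - exists b, sig; split; auto.
Qed.

Definition jet_eval {m k} (i : Fin.t m) (g : vec m -> R) (P : mpoly k) (x : vec m) : R :=
  mp_eval P (fun l : Fin.t k => pderivn i (fval l) g x).

Lemma jet_eval_cont {m k} dom g (i : Fin.t m) (P : mpoly k) x :
  analytic_at dom g x -> cont_at (jet_eval i g P) x.
Proof.
  intros Ha. apply (subring_mp_eval _ k P (fun l => pderivn i (fval l) g) (cont_at_subring x)
    (cont_at_const x)).
  intros l; apply (pderivn_cont dom); auto.
Qed.

(** The relation restricted to the segment is a polynomial in analytic functions of the parameter,
    hence analytic, and the identity theorem on [0,1] applies. *)
Lemma jet_eval_segment {m k} dom g (i : Fin.t m) (P : mpoly k) p q delta :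
  (forall t, 0 <= t <= 1 -> analytic_at dom g (line p (fun j => q j - p j) t)) ->
  0 < delta ->
  (forall t, 0 <= t < delta -> jet_eval i g P (line p (fun j => q j - p j) t) = 0) ->
  jet_eval i g P q = 0.
Proof.
  intros Ha Hd H.
  replace q with (line p (fun j => q j - p j) 1) at 1.
  2:{ apply functional_extensionality; intro j; unfold line; ring. }
  apply (analytic1_zero (fun t => jet_eval i g P (line p (fun j => q j - p j) t)) delta); auto.
  intros t Ht.
  apply (subring_mp_eval _ k P (fun l t => pderivn i (fval l) g (line p (fun j => q j - p j) t))
    (analytic1_subring t) (fun c => analytic1_const c t)).
  intros l. apply (pderivn_line_analytic dom); auto.
Qed.

(** * Connectedness, Baire category and countability *)

Lemma in_ball_center {m} (x : vec m) r : 0 < r -> in_ball x r x.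
Proof. intros H j. rewrite Rminus_eq_0, Rabs_R0; auto. Qed.

Lemma in_ball_trans {m} (x y z : vec m) r e :
  in_ball x r y -> in_ball y e z -> in_ball x (r + e) z.
Proof.
  intros H1 H2 j. replace (z j - x j) with ((y j - x j) + (z j - y j)) by ring.
  eapply Rle_lt_trans; [apply Rabs_triang|]. specialize (H1 j); specialize (H2 j); lra.
Qed.

Lemma ball_open {m} (x : vec m) r : is_open (in_ball x r).
Proof.
  intros y Hy.
  destruct (fin_uniform (fun j e => Rabs (y j - x j) + e <= r)) as (e & He & H).
  - intros j e e' He H; lra.
  - intros j; exists (r - Rabs (y j - x j)). specialize (Hy j). split; lra.
  - exists e; split; auto. intros z Hz j.
    replace (z j - x j) with ((y j - x j) + (z j - y j)) by ring.
    eapply Rle_lt_trans; [apply Rabs_triang|]. specialize (H j); specialize (Hz j); lra.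
Qed.

Lemma convex_comb_lt a b r t : a < r -> b < r -> 0 <= t <= 1 -> (1 - t) * a + t * b < r.
Proof.
  intros H1 H2 Ht. destruct (Req_dec t 0) as [->|Ht0]; [lra|].
  assert (0 < t * (r - b)) by (apply Rmult_lt_0_compat; lra).
  assert (0 <= (1 - t) * (r - a)) by (apply Rmult_le_pos; lra). lra.
Qed.

Lemma ball_convex {m} (x p q : vec m) r t :
  in_ball x r p -> in_ball x r q -> 0 <= t <= 1 ->
  in_ball x r (line p (fun j => q j - p j) t).
Proof.
  intros Hp Hq Ht j. specialize (Hp j); specialize (Hq j).
  apply Rabs_def2 in Hp, Hq. unfold line.
  replace (p j + t * (q j - p j) - x j) with ((1 - t) * (p j - x j) + t * (q j - x j)) by ring.
  assert (H1 := convex_comb_lt (p j - x j) (q j - x j) r t ltac:(lra) ltac:(lra) Ht).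
  assert (H2 := convex_comb_lt (- (p j - x j)) (- (q j - x j)) r t ltac:(lra) ltac:(lra) Ht).
  apply Rabs_def1; lra.
Qed.

Lemma unit_interval_connected (A B : R -> Prop) :
  (forall t, 0 <= t <= 1 -> A t \/ B t) ->
  (forall t, 0 <= t <= 1 -> A t -> B t -> False) ->
  (forall t, A t -> exists e, 0 < e /\ forall s, Rabs (s - t) < e -> A s) ->
  (forall t, B t -> exists e, 0 < e /\ forall s, Rabs (s - t) < e -> B s) ->
  A 0 -> B 1 -> False.
Proof.
  intros Hc Hd HA HB H0 H1.
  set (E := fun T => 0 <= T <= 1 /\ forall t, 0 <= t <= T -> A t).
  destruct (completeness E) as [T [HT1 HT2]].
  { exists 1; intros T [HT _]; lra. }
  { exists 0; split; [lra|]. intros t Ht. replace t with 0 by lra; auto. }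
  assert (HE0 : E 0).
  { split; [lra|]. intros t Ht. replace t with 0 by lra; auto. }
  assert (HT : 0 <= T <= 1).
  { split; [apply HT1; auto|]. apply HT2; intros x [Hx _]; lra. }
  assert (Hz : forall t, 0 <= t < T -> A t).
  { intros t Ht. apply NNPP; intros Hn.
    apply (Rlt_not_le T t); [lra|]. apply HT2. intros x [Hx Hx'].
    apply Rnot_lt_le; intros Hlt. apply Hn, Hx'; lra. }
  destruct (Hc T HT) as [HAT|HBT].
  - destruct (Req_dec T 1) as [->|HT']; [apply (Hd 1); auto; lra|].
    destruct (HA T HAT) as (e & He & HeA).
    set (e' := Rmin (e / 2) (1 - T)).
    assert (He' : 0 < e') by (apply Rmin_pos; lra).
    assert (He1 : e' <= e / 2) by apply Rmin_l.
    assert (He2 : e' <= 1 - T) by apply Rmin_r.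
    assert (HE : E (T + e')).
    { split; [lra|]. intros t Ht. destruct (Rlt_le_dec t T); [apply Hz; lra|].
      apply HeA. rewrite Rabs_pos_eq; lra. }
    specialize (HT1 _ HE). lra.
  - destruct (Req_dec T 0) as [->|HT']; [apply (Hd 0); auto; lra|].
    destruct (HB T HBT) as (e & He & HeB).
    set (e' := Rmin (e / 2) T).
    assert (He' : 0 < e') by (apply Rmin_pos; lra).
    assert (He1 : e' <= e / 2) by apply Rmin_l.
    assert (He2 : e' <= T) by apply Rmin_r.
    apply (Hd (T - e')); [lra|apply Hz; lra|apply HeB].
    replace (T - e' - T) with (- e') by ring. rewrite Rabs_Ropp, Rabs_pos_eq; lra.
Qed.

Lemma open_line {m} (U : vec m -> Prop) p v t : is_open U -> U (line p v t) ->
  exists e, 0 < e /\ forall s, Rabs (s - t) < e -> U (line p v s).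
Proof.
  intros HU Ht. destruct (HU _ Ht) as (r & Hr & H).
  destruct (line_in_ball p v t r Hr) as (e & He & H').
  exists e; split; auto.
Qed.

Lemma line_0 {m} (p v : vec m) : line p v 0 = p.
Proof. apply functional_extensionality; intro j; unfold line; ring. Qed.

Lemma line_1 {m} (p q : vec m) : line p (fun j => q j - p j) 1 = q.
Proof. apply functional_extensionality; intro j; unfold line; ring. Qed.

Lemma ball_connected {m} (x : vec m) r : is_connected (in_ball x r).
Proof.
  intros U V HU HV Hc Hd [u [Hu HuU]] [v [Hv HvV]].
  set (w := fun j => v j - u j).
  assert (Hb : forall t, 0 <= t <= 1 -> in_ball x r (line u w t)).
  { intros t Ht; apply ball_convex; auto. }
  apply (unit_interval_connected (fun t => U (line u w t)) (fun t => V (line u w t))).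
  - intros t Ht; apply Hc; auto.
  - intros t Ht; apply Hd; auto.
  - intros t; apply open_line; auto.
  - intros t; apply open_line; auto.
  - rewrite line_0; auto.
  - unfold w; rewrite line_1; auto.
Qed.

Lemma jet_eval_ball {m k} dom g (i : Fin.t m) (P : mpoly k) x r y e :
  (forall z, in_ball x r z -> analytic_at dom g z) ->
  in_ball x r y -> 0 < e -> (forall z, in_ball y e z -> jet_eval i g P z = 0) ->
  forall q, in_ball x r q -> jet_eval i g P q = 0.
Proof.
  intros Ha Hy He H q Hq.
  destruct (line_in_ball y (fun j => q j - y j) 0 e He) as (delta & Hd & Hl).
  apply (jet_eval_segment dom g i P y q delta); auto.
  - intros t Ht; apply Ha, ball_convex; auto.
  - intros t Ht. apply H. rewrite line_0 in Hl. apply Hl.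
    rewrite Rminus_0_r, Rabs_pos_eq; lra.
Qed.

(** [U] is the interior of the zero set and [V] the interior of its complement. A ball inside [J]
    that meets [U] lies in the zero set by continuation along segments, so [U] and [V] cover [J] and
    connectedness excludes [V]. *)
Lemma jet_eval_connected {m k} dom g (i : Fin.t m) (P : mpoly k) (J : vec m -> Prop) y e :
  (forall z, J z -> analytic_at dom g z) -> is_open J -> is_connected J ->
  J y -> 0 < e -> (forall z, in_ball y e z -> jet_eval i g P z = 0) ->
  forall x, J x -> jet_eval i g P x = 0.
Proof.
  intros Ha HJ Hc Hy He H x Hx. apply NNPP; intros Hn.
  set (U := fun z => exists e, 0 < e /\ forall q, in_ball z e q -> jet_eval i g P q = 0).
  set (V := fun z => exists e, 0 < e /\ forall q, in_ball z e q -> ~ U q).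
  assert (HV : forall z, V z -> ~ U z).
  { intros z (e' & He' & Hz). apply Hz, in_ball_center; auto. }
  assert (HUV : forall z, J z -> U z \/ V z).
  { intros z Hz. destruct (HJ z Hz) as (r & Hr & Hb).
    destruct (classic (exists q, in_ball z r q /\ U q)) as [(q & Hq & e' & He' & Hq')|Hno].
    - left. exists r; split; auto.
      apply (jet_eval_ball dom g i P z r q e'); auto.
    - right. exists r; split; auto. intros q Hq HU; apply Hno; eauto. }
  apply (Hc U V).
  - intros z (r & Hr & Hz). exists (r / 2); split; [lra|].
    intros q Hq. exists (r / 2); split; [lra|]. intros q' Hq'. apply Hz.
    replace r with (r / 2 + r / 2) by field. eapply in_ball_trans; eauto.
  - intros z (r & Hr & Hz). exists (r / 2); split; [lra|].
    intros q Hq. exists (r / 2); split; [lra|]. intros q' Hq'. apply Hz.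
    replace r with (r / 2 + r / 2) by field. eapply in_ball_trans; eauto.
  - exact HUV.
  - intros z Hz HU HV'. apply (HV z); auto.
  - exists y; split; auto. exists e; auto.
  - exists x; split; auto. destruct (HUV x Hx) as [(e' & He' & HU)|]; auto.
    exfalso; apply Hn, HU, in_ball_center; auto.
Qed.

(** * Nested closed cubes and the Baire argument *)

Definition in_cube {m} (x : vec m) (r : R) (y : vec m) : Prop := forall j, Rabs (y j - x j) <= r.

(** In each coordinate every left end is at most every right end, so the supremum of the left ends
    lies in all the intervals. *)
Lemma nested_cubes {m} (z : nat -> vec m * R) :
  (forall q, 0 < snd (z q)) ->
  (forall q y, in_cube (fst (z (S q))) (snd (z (S q))) y -> in_cube (fst (z q)) (snd (z q)) y) ->
  exists x, forall q, in_cube (fst (z q)) (snd (z q)) x.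
Proof.
  intros Hr Hn.
  assert (Hn' : forall q q', (q <= q')%nat -> forall y,
    in_cube (fst (z q')) (snd (z q')) y -> in_cube (fst (z q)) (snd (z q)) y).
  { intros q q' Hq; induction Hq; auto. }
  assert (Hlu : forall q q' j, fst (z q) j - snd (z q) <= fst (z q') j + snd (z q')).
  { intros q q' j.
    assert (Hc : in_cube (fst (z (max q q'))) (snd (z (max q q'))) (fst (z (max q q')))).
    { intros l; rewrite Rminus_eq_0, Rabs_R0; left; auto. }
    assert (H1 := Hn' q (max q q') ltac:(lia) _ Hc j).
    assert (H2 := Hn' q' (max q q') ltac:(lia) _ Hc j).
    apply Rabs_le_between in H1, H2. lra. }
  destruct (choice_fun (fun j x => is_lub (fun y => exists q, y = fst (z q) j - snd (z q)) x)) as [x Hx].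
  { intros j.
    destruct (completeness (fun y => exists q, y = fst (z q) j - snd (z q))) as [l Hl].
    - exists (fst (z 0%nat) j + snd (z 0%nat)). intros y [q ->]; apply Hlu.
    - exists (fst (z 0%nat) j - snd (z 0%nat)), 0%nat; reflexivity.
    - exists l; auto. }
  exists x; intros q j. destruct (Hx j) as [H1 H2]. apply Rabs_le.
  assert (fst (z q) j - snd (z q) <= x j) by (apply H1; eauto).
  assert (x j <= fst (z q) j + snd (z q)) by (apply H2; intros y [q' ->]; apply Hlu).
  lra.
Qed.

(** If no [C q] contained a ball, every ball in [U] would contain a closed cube avoiding [C q].
    Iterating over q, a common point of the nested cubes would lie in [U] but in no [C q]. *)
Lemma baire {m} (U : vec m -> Prop) (C : nat -> vec m -> Prop) :
  is_open U -> (exists x, U x) -> (forall x, U x -> exists q, C q x) ->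
  (forall q, is_open (fun x => U x /\ ~ C q x)) ->
  exists q x e, 0 < e /\ forall y, in_ball x e y -> U y /\ C q y.
Proof.
  intros HU [x0 Hx0] Hcov HC. apply NNPP; intros Hno.
  set (valid := fun w : vec m * R => 0 < snd w /\ forall y, in_ball (fst w) (snd w) y -> U y).
  (* The requirement is conditional on validity, so that [step] is a total function that can be
     iterated. *)
  destruct (choice_fun (fun (qw : nat * (vec m * R)) w' => valid (snd qw) ->
     valid w' /\ forall y, in_cube (fst w') (snd w') y ->
        in_ball (fst (snd qw)) (snd (snd qw)) y /\ ~ C (fst qw) y)) as [step Hstep].
  { intros [q [x r]]. simpl.
    destruct (classic (valid (x, r))) as [[Hr Hb]|Hv]; [|exists (x, r); tauto].
    simpl in Hr, Hb.
    destruct (classic (exists y, in_ball x r y /\ ~ C q y)) as [(y & Hy & Hyq)|Hall].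
    2:{ exfalso; apply Hno. exists q, x, r; split; auto. intros y Hy; split; auto.
        apply NNPP; intros Hn; apply Hall; eauto. }
    destruct (HC q y (conj (Hb y Hy) Hyq)) as (e & He & Heq).
    destruct (ball_open x r y Hy) as (e' & He' & Heb).
    assert (H1 := Rmin_l e e'). assert (H2 := Rmin_r e e').
    assert (H3 := Rmin_pos e e' He He').
    assert (Hcube : forall z, in_cube y (Rmin e e' / 2) z -> in_ball y (Rmin e e') z).
    { intros z Hz j; specialize (Hz j); lra. }
    (* Halving the radius puts the closed cube inside the open ball on which both conditions
       hold. *)
    exists (y, Rmin e e' / 2). intros _. split; [split; simpl|simpl].
    - lra.
    - intros z Hz. apply (Heq z). eapply in_ball_le; [|exact Hz]. lra.
    - intros z Hz. apply Hcube in Hz. split.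
      + apply Heb. eapply in_ball_le; [|exact Hz]; lra.
      + apply (Heq z). eapply in_ball_le; [|exact Hz]; lra. }
  destruct (HU x0 Hx0) as (r0 & Hr0 & Hb0).
  set (z := fix z q := match q with O => (x0, r0) | S q' => step (q', z q') end).
  assert (Hz : forall q, valid (z q)).
  { induction q as [|q IH]; [split; auto|]. apply (Hstep (q, z q) IH). }
  assert (Hin : forall q y, in_cube (fst (z (S q))) (snd (z (S q))) y ->
     in_ball (fst (z q)) (snd (z q)) y /\ ~ C q y).
  { intros q. apply (Hstep (q, z q) (Hz q)). }
  destruct (nested_cubes z) as [x Hx].
  { intros q; apply Hz. }
  { intros q y Hy j. left. apply (Hin q y Hy). }
  destruct (Hcov x) as [q Hq].
  { apply (proj2 (Hz 0%nat)), (Hin 0%nat), Hx. }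
  apply (Hin q x); auto.
Qed.

(** * Enumeration of the integer polynomials *)

Fixpoint boxlist (k d : nat) : list (mindex k) :=
  match k with
  | O => cons (fun j => Fin.case0 (fun _ => nat) j) nil
  | S k' => flat_map (fun e => map (fin_cons e) (boxlist k' d)) (seq 0 (S d))
  end.

Lemma boxlist_in k d (a : mindex k) : In a (boxlist k d) <-> in_box d a.
Proof.
  induction k as [|k IH].
  - split.
    + intros _ j; apply (Fin.case0 (fun j => a j <= d)%nat j).
    + intros _; left; apply mindex0_eq.
  - cbn [boxlist]. rewrite in_flat_map. rewrite <- (fin_cons_eta a), in_box_cons. split.
    + intros (e & He & H). apply in_map_iff in H as (b & E & Hb).
      rewrite in_seq in He. rewrite <- IH.
      assert (E1 := f_equal (fun h => h Fin.F1) E). simpl in E1.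
      assert (E2 := f_equal (fun (h : mindex (S k)) j => h (Fin.FS j)) E).
      simpl in E2. rewrite <- E1. split; [lia|]. change (In (fun j => a (Fin.FS j)) (boxlist k d)).
      rewrite <- E2. exact Hb.
    + intros [H1 H2]. exists (a Fin.F1). split; [apply in_seq; lia|].
      apply in_map, IH, H2.
Qed.

Definition zdecode (u : nat) : Z :=
  let (a, b) := Cantor.of_nat u in (Z.of_nat a - Z.of_nat b)%Z.

Lemma zdecode_surj z : exists u, zdecode u = z.
Proof.
  exists (Cantor.to_nat (Z.to_nat z, Z.to_nat (- z))).
  unfold zdecode. rewrite Cantor.cancel_of_to. lia.
Qed.

(** The code is unpaired into the value at the head and a code for the rest. Multi-indices are
    functions, so their equality is decided classically. *)
Fixpoint enum_fun {T : Type} (l : list T) (u : nat) : T -> Z :=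
  match l with
  | nil => fun _ => 0%Z
  | cons b l' => fun x =>
      let (v, w) := Cantor.of_nat u in
      if excluded_middle_informative (x = b) then zdecode v else enum_fun l' w x
  end.

Lemma enum_fun_surj {T : Type} (l : list T) (c : T -> Z) :
  exists u, forall x, In x l -> enum_fun l u x = c x.
Proof.
  induction l as [|b l [w IH]]; [exists 0%nat; intros x []|].
  destruct (zdecode_surj (c b)) as [v Hv].
  exists (Cantor.to_nat (v, w)). intros x Hx. cbn [enum_fun].
  rewrite Cantor.cancel_of_to.
  destruct (excluded_middle_informative (x = b)) as [->|n]; auto.
  apply IH. destruct Hx as [E|Hx]; [congruence|auto].
Qed.

Definition enum_mpoly (k u : nat) : mpoly k :=
  let (d, w) := Cantor.of_nat u in MPoly k d (fun a => IZR (enum_fun (boxlist k d) w a)).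

Lemma enum_mpoly_int k u : mp_intcoef (enum_mpoly k u).
Proof. unfold enum_mpoly. destruct (Cantor.of_nat u). intros a _; simpl; eauto. Qed.

(** Only the finitely many coefficients in the box are encoded, so [P] is recovered up to its values
    outside the box; evaluation and nonvanishing do not see those. *)
Lemma enum_mpoly_surj k (P : mpoly k) : mp_intcoef P -> mp_nonzero P ->
  exists u, mp_nonzero (enum_mpoly k u) /\ forall y, mp_eval (enum_mpoly k u) y = mp_eval P y.
Proof.
  intros HP [a [Ha Hn]].
  destruct (choice_fun (fun a z => in_box (mp_deg P) a -> mp_coef P a = IZR z)) as [c Hc].
  { intros b. destruct (classic (in_box (mp_deg P) b)) as [H|H]; [|exists 0%Z; tauto].
    destruct (HP b H) as [z Hz]; eauto. }
  destruct (enum_fun_surj (boxlist k (mp_deg P)) c) as [w Hw].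
  exists (Cantor.to_nat (mp_deg P, w)). unfold enum_mpoly. rewrite Cantor.cancel_of_to.
  assert (E : forall b, in_box (mp_deg P) b ->
     IZR (enum_fun (boxlist k (mp_deg P)) w b) = mp_coef P b).
  { intros b Hb. rewrite Hw by (apply boxlist_in; auto). symmetry; auto. }
  split.
  - exists a; split; auto. simpl. rewrite E; auto.
  - intros y. unfold mp_eval; simpl. apply sum_box_ext; intros b Hb. rewrite E; auto.
Qed.

Lemma jet_relation_connected {m} dom g (i : Fin.t m) (J : vec m -> Prop) :
  (forall z, J z -> analytic_at dom g z) -> is_open J -> is_connected J -> (exists x, J x) ->
  (forall x, J x -> exists k (P : mpoly k), mp_nonzero P /\ mp_intcoef P /\ jet_eval i g P x = 0) ->
  exists k (P : mpoly k), mp_nonzero P /\ mp_intcoef P /\ forall x, J x -> jet_eval i g P x = 0.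
Proof.
  intros Ha HJ Hc Hne H.
  (* One number codes arity and polynomial together. A code of a zero polynomial gets the empty set,
     so the [C q] that Baire returns carries a genuine relation. *)
  set (C := fun q x => let (k, u) := Cantor.of_nat q in
     mp_nonzero (enum_mpoly k u) /\ jet_eval i g (enum_mpoly k u) x = 0).
  destruct (baire J C HJ Hne) as (q & x & e & He & Hb).
  - intros x Hx. destruct (H x Hx) as (k & P & H1 & H2 & H3).
    destruct (enum_mpoly_surj k P H2 H1) as (u & H4 & H5).
    exists (Cantor.to_nat (k, u)). unfold C. rewrite Cantor.cancel_of_to. split; auto.
    unfold jet_eval. rewrite H5. exact H3.
  - intros q x [Hx Hq]. unfold C in *. destruct (Cantor.of_nat q) as [k u].
    destruct (HJ x Hx) as (r & Hr & Hrb).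
    destruct (classic (mp_nonzero (enum_mpoly k u))) as [Hnz|Hnz].
    2:{ exists r; split; auto. intros y Hy; split; auto. tauto. }
    assert (Hn : jet_eval i g (enum_mpoly k u) x <> 0) by tauto.
    destruct (jet_eval_cont dom g i (enum_mpoly k u) x (Ha x Hx) _ (Rabs_pos_lt _ Hn))
      as (d & Hd & Hdb).
    exists (Rmin r d); split; [apply Rmin_pos; auto|]. intros y Hy; split.
    + apply Hrb. eapply in_ball_le; [apply Rmin_l|exact Hy].
    + intros [_ E]. specialize (Hdb y (in_ball_le _ _ _ _ (Rmin_r _ _) Hy)).
      rewrite E, Rminus_0_l, Rabs_Ropp in Hdb. lra.
  - unfold C in Hb. destruct (Cantor.of_nat q) as [k u].
    exists k, (enum_mpoly k u).
    assert (Hx := in_ball_center x e He).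
    split; [apply (Hb x Hx)|]. split; [apply enum_mpoly_int|].
    apply (jet_eval_connected dom g i _ J x e); auto.
    + apply (Hb x Hx).
    + intros z Hz; apply (Hb z Hz).
Qed.

(** * Uniform arity, and (iv) => (i) *)

(** Box sums recurse on the first variable, whereas the highest derivative, to be split off or
    added, is the last one. *)
Fixpoint snoc {A : Type} {k : nat} : (Fin.t k -> A) -> A -> Fin.t (S k) -> A :=
  match k with
  | O => fun _ e _ => e
  | S k' => fun a e => fin_cons (a Fin.F1) (snoc (fun j => a (Fin.FS j)) e)
  end.

Fixpoint flast {A : Type} {k : nat} : (Fin.t (S k) -> A) -> A :=
  match k with
  | O => fun a => a Fin.F1
  | S k' => fun a => flast (fun j => a (Fin.FS j))
  end.

Fixpoint finit {A : Type} {k : nat} : (Fin.t (S k) -> A) -> Fin.t k -> A :=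
  match k with
  | O => fun a j => Fin.case0 (fun _ => A) j
  | S k' => fun a => fin_cons (a Fin.F1) (finit (fun j => a (Fin.FS j)))
  end.

Lemma flast_snoc {A k} (a : Fin.t k -> A) e : flast (snoc a e) = e.
Proof. induction k as [|k IH]; simpl; [reflexivity|apply IH]. Qed.

Lemma finit_snoc {A k} (a : Fin.t k -> A) e : finit (snoc a e) = a.
Proof.
  induction k as [|k IH].
  - apply functional_extensionality; intro j; apply (Fin.case0 (fun j => _ j = a j) j).
  - cbn [snoc finit]. etransitivity; [|apply fin_cons_eta]. f_equal. apply IH.
Qed.

Lemma snoc_finit {A k} (a : Fin.t (S k) -> A) : snoc (finit a) (flast a) = a.
Proof.
  induction k as [|k IH].
  - apply functional_extensionality; intro j; revert j. apply fin_caseS; [reflexivity|].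
    intros j; apply (Fin.case0 (fun j => _ = a (Fin.FS j)) j).
  - cbn [snoc finit flast]. etransitivity; [|apply fin_cons_eta]. f_equal. apply IH.
Qed.

Lemma in_box_snoc {k} d e (a : mindex k) :
  in_box d (snoc a e) <-> (e <= d)%nat /\ in_box d a.
Proof.
  induction k as [|k IH].
  - split.
    + intros H; split; [apply (H Fin.F1)|]. intros j; apply (Fin.case0 (fun j => a j <= d)%nat j).
    + intros [H _] j; apply H.
  - cbn [snoc]. rewrite <- (fin_cons_eta a) at 2. rewrite !in_box_cons, IH. tauto.
Qed.

Lemma sum_exchange (F : nat -> nat -> R) n p :
  sum_f_R0 (fun i => sum_f_R0 (F i) p) n = sum_f_R0 (fun j => sum_f_R0 (fun i => F i j) n) p.
Proof.
  induction n as [|n IH]; simpl; [reflexivity|]. rewrite IH, sum_plus. reflexivity.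
Qed.

Lemma sum_box_snoc k d (F : mindex (S k) -> R) :
  sum_box (S k) d F = sum_f_R0 (fun e => sum_box k d (fun a => F (snoc a e))) d.
Proof.
  induction k as [|k IH].
  - simpl. apply sum_eq; intros e _. f_equal.
    apply functional_extensionality; intro j; revert j. apply fin_caseS; [reflexivity|].
    intros j; apply (Fin.case0 (fun j => _ = e) j).
  - transitivity (sum_f_R0 (fun e0 => sum_f_R0 (fun e =>
      sum_box k d (fun a => F (fin_cons e0 (snoc a e)))) d) d).
    + apply sum_eq; intros e0 _. apply (IH (fun a => F (fin_cons e0 a))).
    + rewrite sum_exchange. reflexivity.
Qed.

Lemma fval_FS {k} (j : Fin.t k) : fval (Fin.FS j) = S (fval j).
Proof. unfold fval. simpl. destruct (Fin.to_nat j); reflexivity. Qed.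

(** Arguments are read from a sequence [h] on the natural numbers so that the induction can pass to
    the shifted sequence. *)
Lemma prod_fin_snoc k (a : mindex k) e (h : nat -> R) :
  prod_fin (S k) (fun j => h (fval j) ^ snoc a e j)
  = prod_fin k (fun j => h (fval j) ^ a j) * h k ^ e.
Proof.
  revert h; induction k as [|k IH]; intros h; [unfold fval; simpl; ring|].
  change (h (fval (@Fin.F1 (S k))) ^ a Fin.F1 *
    prod_fin (S k) (fun j => h (fval (Fin.FS j)) ^ snoc (fun j => a (Fin.FS j)) e j)
    = h (fval (@Fin.F1 k)) ^ a Fin.F1 * prod_fin k (fun j => h (fval (Fin.FS j)) ^ a (Fin.FS j))
      * h (S k) ^ e).
  rewrite (prod_fin_ext (S k) _ (fun j => h (S (fval j)) ^ snoc (fun j => a (Fin.FS j)) e j))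
    by (intros j; rewrite fval_FS; reflexivity).
  rewrite (IH (fun j => a (Fin.FS j)) (fun l => h (S l))).
  rewrite (prod_fin_ext k (fun j => h (fval (Fin.FS j)) ^ a (Fin.FS j))
    (fun j => h (S (fval j)) ^ a (Fin.FS j))) by (intros j; rewrite fval_FS; reflexivity).
  unfold fval; simpl. ring.
Qed.

Definition mp_pad {k} (P : mpoly k) : mpoly (S k) :=
  MPoly (S k) (mp_deg P) (fun a => if flast a =? 0 then mp_coef P (finit a) else 0).

Lemma mp_pad_nonzero {k} (P : mpoly k) : mp_nonzero P -> mp_nonzero (mp_pad P).
Proof.
  intros [a [Ha Hn]]. exists (snoc a 0%nat). split.
  - apply in_box_snoc; split; auto; lia.
  - simpl. rewrite flast_snoc, finit_snoc. exact Hn.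
Qed.

Lemma mp_pad_intcoef {k} (P : mpoly k) : mp_intcoef P -> mp_intcoef (mp_pad P).
Proof.
  intros H a Ha. rewrite <- (snoc_finit a) in Ha. apply in_box_snoc in Ha as [_ Ha].
  simpl. destruct (flast a =? 0); [apply H; auto|exists 0%Z; reflexivity].
Qed.

Lemma mp_pad_eval {k} (P : mpoly k) (h : nat -> R) :
  mp_eval (mp_pad P) (fun l => h (fval l)) = mp_eval P (fun l => h (fval l)).
Proof.
  unfold mp_eval. rewrite sum_box_snoc. cbn [mp_pad mp_deg mp_coef].
  assert (E : forall e, sum_box k (mp_deg P) (fun a =>
      (if flast (snoc a e) =? 0 then mp_coef P (finit (snoc a e)) else 0) *
      prod_fin (S k) (fun j => h (fval j) ^ snoc a e j)) =
    if e =? 0 then sum_box k (mp_deg P)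
       (fun a => mp_coef P a * prod_fin k (fun j => h (fval j) ^ a j)) else 0).
  { intros e. destruct (Nat.eqb_spec e 0) as [->|n].
    - apply sum_box_ext; intros a _. rewrite flast_snoc, finit_snoc, prod_fin_snoc. simpl. ring.
    - transitivity (sum_box k (mp_deg P) (fun a => 0 * 0)).
      + apply sum_box_ext; intros a _. rewrite flast_snoc.
        destruct (Nat.eqb_spec e 0); [lia|ring].
      + rewrite sum_box_scal; ring. }
  rewrite (sum_eq _ _ _ (fun e _ => E e)).
  set (v := sum_box k (mp_deg P) _). clearbody v. clear E.
  induction (mp_deg P) as [|d IH]; simpl; [reflexivity|]. rewrite IH; ring.
Qed.

Lemma common_arity {n} (Q : Fin.t n -> forall k, mpoly k -> Prop) :
  (forall j k P, Q j k P -> exists P', Q j (S k) P') ->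
  (forall j, exists k P, Q j k P) ->
  exists k (P : Fin.t n -> mpoly k), forall j, Q j k (P j).
Proof.
  intros Hpad H.
  assert (Hup : forall j k k' P, (k <= k')%nat -> Q j k P -> exists P', Q j k' P').
  { intros j k k' P Hk; revert P; induction Hk as [|k' Hk IH]; eauto.
    intros P HP. destruct (IH P HP) as [P' HP']; eauto. }
  assert (HK : exists k, forall j, exists P, Q j k P).
  { clear Hpad. induction n as [|n IH].
    - exists 0%nat. intros j; apply (Fin.case0 (fun j => exists P, Q j 0%nat P) j).
    - destruct (IH (fun j => Q (Fin.FS j))) as [k Hk]; auto.
      { intros j k k' P; apply Hup. }
      destruct (H Fin.F1) as (k' & P & HP).
      exists (max k k'). apply fin_caseS.
      + apply (Hup _ k' _ P); auto; lia.
      + intros j. destruct (Hk j) as [P' HP']. apply (Hup _ k _ P'); auto; lia. }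
  destruct HK as [k Hk]. destruct (choice_fun _ Hk) as [P HP]. eauto.
Qed.

Lemma common_arity_jet {m n} (i : Fin.t m) (f : vec m -> vec n) (J : vec m -> Prop) :
  (forall j, exists k (P : mpoly k), mp_nonzero P /\ mp_intcoef P /\
     forall x, J x -> jet_eval i (fun z => f z j) P x = 0) ->
  exists k (P : Fin.t n -> mpoly k), admissible true P /\ forall x, J x -> star f i P x.
Proof.
  intros H.
  destruct (common_arity (fun j k P => mp_nonzero P /\ mp_intcoef P /\
     forall x, J x -> jet_eval i (fun z => f z j) P x = 0)) as (k & P & HP); auto.
  - intros j k P (H1 & H2 & H3). exists (mp_pad P).
    split; [apply mp_pad_nonzero, H1|]. split; [apply mp_pad_intcoef, H2|].
    intros x Hx. unfold jet_eval.
    rewrite (mp_pad_eval P (fun l => pderivn i l (fun z => f z j) x)). apply H3; auto.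
  - exists k, P. split.
    + intros j. destruct (HP j) as (H1 & H2 & _); auto.
    + intros x Hx j. apply (HP j); auto.
Qed.

Lemma iv_i {m n} (i : Fin.t m) dom (f : vec m -> vec n) :
  analytic dom f -> stmt_iv dom f i -> stmt_i true dom f i.
Proof.
  intros [_ Ha] H J HJ Hc Hsub.
  apply common_arity_jet. intros j.
  destruct (classic (exists x, J x)) as [Hne|He].
  - apply (jet_relation_connected dom); auto.
    intros x Hx. destruct (H x (Hsub x Hx)) as (k & P & HP & Hs).
    destruct (HP j) as [H1 H2]. exists k, (P j). split; auto. split; auto. apply Hs.
  (* Baire needs a point of [J]; on the empty set the constant polynomial 1 serves. *)
  - exists 0%nat, (MPoly 0 0 (fun _ => 1)). split; [|split].
    + exists (fun _ => 0%nat). split; [intros l; simpl; lia|simpl; lra].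
    + intros a _; exists 1%Z; reflexivity.
    + intros x Hx; exfalso; eauto.
Qed.

(** * Relations with nonvanishing separant *)

Definition poly_at {k} (d : nat) (c : mindex k -> R) (h : nat -> R -> R) (t : R) : R :=
  sum_box k d (fun a => c a * prod_fin k (fun j => h (fval j) t ^ a j)).

Lemma poly_at_snoc {k} d (c : mindex (S k) -> R) h t :
  poly_at d c h t = sum_f_R0 (fun e => poly_at d (fun a => c (snoc a e)) h t * h k t ^ e) d.
Proof.
  unfold poly_at. rewrite sum_box_snoc. apply sum_eq; intros e _.
  rewrite Rmult_comm, <- sum_box_scal. apply sum_box_ext; intros a _.
  rewrite (prod_fin_snoc k a e (fun l => h l t)). ring.
Qed.

Lemma poly_at_0 {k} d (c : mindex k -> R) h t :
  (forall a, in_box d a -> c a = 0) -> poly_at d c h t = 0.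
Proof.
  intros H. unfold poly_at. transitivity (sum_box k d (fun a => 0 * 0)).
  - apply sum_box_ext; intros a Ha; rewrite H; auto; ring.
  - rewrite sum_box_scal; ring.
Qed.

(* A polynomial in h_0, ..., h_k written by powers of h_k, and its derivative in h_k. *)
Definition upoly_at {k} (d D : nat) (p : nat -> mindex k -> R) h t : R :=
  sum_f_R0 (fun e => poly_at d (p e) h t * h k t ^ e) D.

Definition separant_at {k} (d D : nat) (p : nat -> mindex k -> R) h t : R :=
  sum_f_R0 (fun e => INR e * poly_at d (p e) h t * h k t ^ pred e) D.

Lemma continuity_pt_subring t : subring (fun f : R -> R => continuity_pt f t).
Proof.
  split; [|split].
  - apply continuity_pt_const. intros x y; reflexivity.
  - intros f g Hf Hg. apply (continuity_pt_plus f g); auto.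
  - intros f g Hf Hg. apply (continuity_pt_mult f g); auto.
Qed.

Lemma poly_at_closed {k} (C : (R -> R) -> Prop) d (c : mindex k -> R) h :
  subring C -> (forall a, in_box d a -> C (fun _ => c a)) -> (forall l, (l < k)%nat -> C (h l)) ->
  C (poly_at d c h).
Proof.
  intros HC Hc Hh. unfold poly_at.
  apply (subring_sum_box C k d (fun a t => c a * prod_fin k (fun j => h (fval j) t ^ a j)) HC).
  intros a Ha. apply HC; [apply Hc; auto|].
  apply (subring_prod_fin C k (fun j t => h (fval j) t ^ a j) HC).
  intros j. apply subring_pow; auto. apply Hh.
  unfold fval. destruct (Fin.to_nat j); auto.
Qed.

Lemma separant_cont {k} d D (p : nat -> mindex k -> R) h t :
  (forall l, continuity_pt (h l) t) -> continuity_pt (separant_at d D p h) t.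
Proof.
  intros Hh. assert (HC := continuity_pt_subring t).
  apply (subring_sum (fun f : R -> R => continuity_pt f t) D
    (fun e t => INR e * poly_at d (p e) h t * h k t ^ pred e) HC).
  assert (Hcst : forall c, continuity_pt (fun _ => c) t).
  { intros c; apply continuity_pt_const; intros x y; reflexivity. }
  destruct (HC) as (_ & _ & Hm). intros e _.
  apply (Hm (fun t => INR e * poly_at d (p e) h t) (fun t => h k t ^ pred e)).
  - apply (Hm (fun _ => INR e)); [apply Hcst|].
    apply (poly_at_closed (fun f => continuity_pt f t)); auto.
  - apply (subring_pow (fun f => continuity_pt f t) (h k)); auto.
Qed.

Lemma continuity_pt_nonzero f t : continuity_pt f t -> f t <> 0 ->
  exists e, 0 < e /\ forall s, Rabs (s - t) < e -> f s <> 0.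
Proof.
  intros Hc Hn. destruct (Hc (Rabs (f t)) (Rabs_pos_lt _ Hn)) as (e & He & H).
  exists e; split; auto. intros s Hs E.
  destruct (Req_dec t s) as [<-|Hts]; [auto|].
  assert (H' := H s (conj (conj I Hts) Hs)). simpl in H'; unfold Rdist in H'.
  rewrite E, Rminus_0_l, Rabs_Ropp in H'. lra.
Qed.

Definition nonsingular (h : nat -> R -> R) (d : nat) (a b : R) : Prop :=
  exists k D (p : nat -> mindex k -> R) a' b', a <= a' /\ a' < b' /\ b' <= b /\
    forall t, a' < t < b' -> upoly_at d D p h t = 0 /\ separant_at d D p h t <> 0.

(** Induction on the degree [D] in h_k. If h_k does not occur, the relation has lower order and
    [Hlow] applies. If the separant vanishes on all of (a,b), it is itself a nontrivial relation of
    smaller degree. Otherwise it is nonzero at some point, hence around it. *)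
Lemma nonsingular_step (h : nat -> R -> R) a b k d :
  (forall l t, a < t < b -> continuity_pt (h l) t) ->
  (forall c : mindex k -> R, (exists al, in_box d al /\ c al <> 0) ->
      (forall t, a < t < b -> poly_at d c h t = 0) -> nonsingular h d a b) ->
  forall D (p : nat -> mindex k -> R),
  (exists e al, (e <= D)%nat /\ in_box d al /\ p e al <> 0) ->
  (forall t, a < t < b -> upoly_at d D p h t = 0) -> nonsingular h d a b.
Proof.
  intros Hh Hlow. induction D as [|D IHD]; intros p (e & al & He & Hal & Hn) H.
  + apply (Hlow (p 0%nat)).
    * exists al; split; auto. replace 0%nat with e by lia; auto.
    * intros t Ht. rewrite <- (H t Ht). unfold upoly_at. simpl. ring.
  + destruct (classic (exists e al, (1 <= e <= S D)%nat /\ in_box d al /\ p e al <> 0))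
      as [(e' & al' & He' & Hal' & Hn')|Hno].
    2:{ apply (Hlow (p 0%nat)).
        - exists al; split; auto. destruct e; auto. exfalso; apply Hno.
          exists (S e), al; split; [lia|auto].
        - intros t Ht. rewrite <- (H t Ht). unfold upoly_at.
          rewrite decomp_sum by lia. rewrite (sum_eq _ (fun _ => 0)).
          + rewrite sum_cte. simpl. ring.
          + intros j Hj. rewrite poly_at_0; [ring|]. intros be Hbe.
            apply NNPP; intros Hn'. apply Hno. exists (S j), be. split; [simpl in Hj; lia|auto]. }
    assert (Hsep : forall t, separant_at d (S D) p h t
       = upoly_at d D (fun e al => INR (S e) * p (S e) al) h t).
    { intros t. unfold separant_at, upoly_at. rewrite decomp_sum by lia.
      simpl pred at 2. rewrite Rmult_0_l, Rmult_0_l, Rplus_0_l. apply sum_eq; intros j _.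
      simpl pred. f_equal. unfold poly_at. rewrite <- sum_box_scal.
      apply sum_box_ext; intros; ring. }
    destruct (classic (forall t, a < t < b -> separant_at d (S D) p h t = 0)) as [Hz|Hnz].
    * apply (IHD (fun e al => INR (S e) * p (S e) al)).
      -- exists (pred e'), al'. split; [lia|]. split; auto.
         replace (S (pred e')) with e' by lia. apply Rmult_integral_contrapositive; split; auto.
         apply not_0_INR; lia.
      -- intros t Ht. rewrite <- Hsep; auto.
    * apply not_all_ex_not in Hnz as [t1 Hnz]. apply imply_to_and in Hnz as [Ht1 Hnz].
      destruct (continuity_pt_nonzero _ _ (separant_cont d (S D) p h t1
        (fun l => Hh l t1 Ht1)) Hnz) as (eps & Heps & Hs).
      assert (H1 := Rmax_l a (t1 - eps)). assert (H2 := Rmax_r a (t1 - eps)).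
      assert (H3 := Rmin_l b (t1 + eps)). assert (H4 := Rmin_r b (t1 + eps)).
      assert (H5 : Rmax a (t1 - eps) < t1) by (apply Rmax_lub_lt; lra).
      assert (H6 : t1 < Rmin b (t1 + eps)) by (apply Rmin_glb_lt; lra).
      exists k, (S D), p, (Rmax a (t1 - eps)), (Rmin b (t1 + eps)).
      split; [lra|]. split; [lra|]. split; [lra|]. intros t Ht. split; [apply H; lra|].
      apply Hs. apply Rabs_def1; lra.
Qed.

(* Differentiating repeatedly in the leading variable, and dropping it once it no longer
   occurs, ends at a relation whose separant does not vanish on some subinterval. *)
Lemma nonsingular_relation (h : nat -> R -> R) a b k d (c : mindex k -> R) :
  (forall l t, a < t < b -> continuity_pt (h l) t) -> a < b ->
  (exists al, in_box d al /\ c al <> 0) ->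
  (forall t, a < t < b -> poly_at d c h t = 0) -> nonsingular h d a b.
Proof.
  intros Hh Hab. induction k as [|k IHk].
  - intros (al & _ & Hn) H. exfalso; apply Hn.
    specialize (H ((a + b) / 2) ltac:(lra)). unfold poly_at in H. simpl in H.
    rewrite (mindex0_eq _ al), Rmult_1_r in H. exact H.
  - intros (al & Hal & Hn) H.
    apply (nonsingular_step h a b k d Hh IHk d (fun e al => c (snoc al e))).
    + exists (flast al), (finit al). rewrite snoc_finit.
      rewrite <- (snoc_finit al) in Hal. apply in_box_snoc in Hal as [H1 H2]. auto.
    + intros t Ht. unfold upoly_at. rewrite <- poly_at_snoc. auto.
Qed.

(** * A finitely generated ring stable under differentiation *)

Definition derivs_on (a b : R) (g g' : R -> R) : Prop :=
  forall t, a < t < b -> derivable_pt_lim g t (g' t).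

Lemma derivs_on_ext a b f f' g : derivs_on a b f f' ->
  (forall t, a < t < b -> g t = f t) -> derivs_on a b g f'.
Proof.
  intros Hf E t Ht. apply is_derive_Reals.
  apply (is_derive_ext_loc f).
  - assert (He : 0 < Rmin (t - a) (b - t)) by (apply Rmin_pos; lra).
    exists (mkposreal _ He). intros s Hs. symmetry; apply E.
    apply Rabs_def2 in Hs. unfold minus, plus, opp in Hs; simpl in Hs.
    assert (H1 := Rmin_l (t - a) (b - t)). assert (H2 := Rmin_r (t - a) (b - t)). lra.
  - apply is_derive_Reals, Hf; auto.
Qed.

Lemma derivs_on_unique a b g f f' : derivs_on a b g f -> derivs_on a b g f' ->
  forall t, a < t < b -> f t = f' t.
Proof. intros H H' t Ht. eapply uniqueness_limite; eauto. Qed.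

(** Elements are taken up to equality on (a,b): only there are the relation, the inverse of the
    separant and the derivatives under control. *)
Inductive zring (a b : R) (us : list (R -> R)) : (R -> R) -> Prop :=
| zring_const z : zring a b us (fun _ => IZR z)
| zring_gen u : In u us -> zring a b us u
| zring_plus f g : zring a b us f -> zring a b us g -> zring a b us (fun t => f t + g t)
| zring_mult f g : zring a b us f -> zring a b us g -> zring a b us (fun t => f t * g t)
| zring_ext f g : zring a b us f -> (forall t, a < t < b -> g t = f t) -> zring a b us g.

Lemma zring_subring a b us : subring (zring a b us).
Proof.
  split; [apply (zring_const a b us 1)|split].
  - apply zring_plus.
  - apply zring_mult.
Qed.

Lemma zring_INR a b us n : zring a b us (fun _ => INR n).
Proof.
  apply zring_ext with (1 := zring_const a b us (Z.of_nat n)).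
  intros; apply INR_IZR_INZ.
Qed.

(** Leibniz' rule. The derivatives may lie in a larger ring, which lets the closure under d/dt be
    established in stages. *)
Lemma zring_derive a b us us' :
  incl us us' ->
  (forall u, In u us -> exists u', zring a b us' u' /\ derivs_on a b u u') ->
  forall g, zring a b us g -> exists g', zring a b us' g' /\ derivs_on a b g g'.
Proof.
  intros Hincl Hu.
  assert (Hi : forall g, zring a b us g -> zring a b us' g).
  { induction 1; [apply zring_const|apply zring_gen, Hincl; auto|apply zring_plus; auto
      |apply zring_mult; auto|eapply zring_ext; eauto]. }
  induction 1 as [z|u Hin|f g Hf (f' & H1 & H2) Hg (g' & H3 & H4)
    |f g Hf (f' & H1 & H2) Hg (g' & H3 & H4)|f g Hf (f' & H1 & H2) E].
  - exists (fun _ => IZR 0). split; [apply zring_const|].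
    intros t _; apply derivable_pt_lim_const.
  - auto.
  - exists (fun t => f' t + g' t). split; [apply zring_plus; auto|].
    intros t Ht. apply (derivable_pt_lim_plus f g); auto.
  - exists (fun t => f' t * g t + f t * g' t).
    split; [apply zring_plus; apply zring_mult; auto|].
    intros t Ht. apply (derivable_pt_lim_mult f g); auto.
  - exists f'. split; auto. eapply derivs_on_ext; eauto.
Qed.

Lemma derivs_on_pow a b g g' n : derivs_on a b g g' ->
  derivs_on a b (fun t => g t ^ n) (fun t => INR n * g t ^ pred n * g' t).
Proof.
  intros H t Ht. apply (derivable_pt_lim_comp g (fun x => x ^ n)); auto.
  apply derivable_pt_lim_pow.
Qed.

(* Solving the differentiated relation for the next derivative makes the ring generated
   by h_0, ..., h_k, the coefficients and the inverse of the separant stable under d/dt. *)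
Lemma jets_in_zring {k} (h : nat -> R -> R) a b d D (p : nat -> mindex k -> R) :
  (forall l, derivs_on a b (h l) (h (S l))) ->
  (forall t, a < t < b -> upoly_at d D p h t = 0 /\ separant_at d D p h t <> 0) ->
  exists us, forall l, zring a b us (h l).
Proof.
  intros Hh Hp.
  set (sep := separant_at d D p h).
  set (w := fun t => / sep t).
  (* Three stages avoid circularity. Derivatives of [us0] involve at most h_k; this puts h_(k+1)
     into the ring of [us], so [us1] has derivatives there; the separant lies in the ring of [us1],
     and so the derivative of its inverse also lies in the ring of [us]. *)
  set (us0 := (map h (seq 0 k) ++
    flat_map (fun e => map (fun al (_ : R) => p e al) (boxlist k d)) (seq 0 (S D)))%list).
  set (us1 := cons (h k) us0). set (us := cons w us1).
  assert (Hgen : forall vs, incl us0 vs ->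
     (forall l, (l < k)%nat -> zring a b vs (h l)) /\
     (forall e al, (e <= D)%nat -> in_box d al -> zring a b vs (fun _ => p e al))).
  { intros vs Hvs. split.
    - intros l Hl. apply zring_gen, Hvs, in_or_app. left. apply in_map, in_seq; lia.
    - intros e al He Hal. apply zring_gen, Hvs, in_or_app. right.
      apply in_flat_map. exists e. split; [apply in_seq; lia|].
      apply (in_map (fun al (_ : R) => p e al)), boxlist_in; auto. }
  assert (Hcoef : forall vs e, incl us0 vs -> (e <= D)%nat -> zring a b vs (poly_at d (p e) h)).
  { intros vs e Hvs He. destruct (Hgen vs Hvs) as [H1 H2].
    apply poly_at_closed; auto. apply zring_subring. }
  assert (I01 : incl us0 us1) by apply incl_tl, incl_refl.
  assert (I1 : incl us1 us) by apply incl_tl, incl_refl.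
  assert (I0 : incl us0 us) by (eapply incl_tran; eauto).
  assert (Hk1 : zring a b us1 (h k)) by (apply zring_gen; left; reflexivity).
  assert (Hk : zring a b us (h k)) by (apply zring_gen, I1; left; reflexivity).
  assert (Hw : zring a b us w) by (apply zring_gen; left; reflexivity).
  assert (Hu0 : forall u, In u us0 -> exists u', zring a b us u' /\ derivs_on a b u u').
  { intros u Hu. apply in_app_or in Hu as [Hu|Hu].
    - apply in_map_iff in Hu as (l & <- & Hl). apply in_seq in Hl.
      exists (h (S l)). split; [|apply Hh].
      destruct (Nat.eq_dec (S l) k) as [->|n]; auto. apply (Hgen us I0); lia.
    - apply in_flat_map in Hu as (e & _ & Hu). apply in_map_iff in Hu as (al & <- & _).
      exists (fun _ => IZR 0). split; [apply zring_const|].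
      intros t _; apply derivable_pt_lim_const. }
  assert (HSk : zring a b us (h (S k))).
  { destruct (choice_fun (fun e g' => (e <= D)%nat ->
      zring a b us g' /\ derivs_on a b (poly_at d (p e) h) g')) as [q Hq].
    { intros e. destruct (le_dec e D) as [He|He]; [|exists (fun _ => 0); tauto].
      destruct (zring_derive a b us0 us I0 Hu0 (poly_at d (p e) h)) as [g' Hg'].
      - apply Hcoef; auto. apply incl_refl.
      - exists g'; auto. }
    set (T := fun t => sum_f_R0 (fun e => q e t * h k t ^ e) D).
    assert (HT : zring a b us T).
    { assert (HC := zring_subring a b us).
      apply (subring_sum _ D (fun e t => q e t * h k t ^ e) HC).
      intros e He. apply zring_mult; [apply Hq; auto|].
      apply (subring_pow _ (h k) e HC); auto. }
    apply zring_ext with (f := fun t => IZR (-1) * (T t * w t)).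
    { apply (zring_mult a b us (fun _ => IZR (-1))); [apply zring_const|].
      apply zring_mult; auto. }
    (* [T] collects the derivatives of the coefficients, and h_(k+1) occurs linearly with the
       separant as factor. The relation being zero, h_(k+1) = - T / sep. *)
    assert (Hd : derivs_on a b (upoly_at d D p h) (fun t => T t + sep t * h (S k) t)).
    { intros t Ht. unfold upoly_at, T, sep, separant_at.
      rewrite Rmult_comm, scal_sum, <- sum_plus.
      apply (sum_derivable D (fun e t => poly_at d (p e) h t * h k t ^ e)
        (fun e t => q e t * h k t ^ e
           + INR e * poly_at d (p e) h t * h k t ^ pred e * h (S k) t)).
      intros e He.
      replace (q e t * h k t ^ e + INR e * poly_at d (p e) h t * h k t ^ pred e * h (S k) t)
        with (q e t * h k t ^ e + poly_at d (p e) h t * (INR e * h k t ^ pred e * h (S k) t)) by ring.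
      apply (derivable_pt_lim_mult (poly_at d (p e) h) (fun t => h k t ^ e)).
      - apply (Hq e He); auto.
      - apply (derivs_on_pow a b (h k) (h (S k)) e (Hh k)); auto. }
    assert (H0 : derivs_on a b (upoly_at d D p h) (fun _ => 0)).
    { apply derivs_on_ext with (fun _ => 0); [|apply Hp].
      intros t _; apply derivable_pt_lim_const. }
    intros t Ht. assert (E := derivs_on_unique a b _ _ _ Hd H0 t Ht). simpl in E.
    unfold w. destruct (Hp t Ht) as [_ Hn]. fold sep in Hn.
    apply Rmult_eq_reg_l with (sep t); auto.
    replace (sep t * h (S k) t) with (- T t) by lra. field; auto. }
  assert (Hu1 : forall u, In u us1 -> exists u', zring a b us u' /\ derivs_on a b u u').
  { intros u [<-|Hu]; [exists (h (S k)); split; auto|auto]. }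
  assert (Hsep : zring a b us1 sep).
  { assert (HC := zring_subring a b us1).
    apply (subring_sum _ D (fun e t => INR e * poly_at d (p e) h t * h k t ^ pred e) HC).
    intros e He.
    apply (zring_mult a b us1 (fun t => INR e * poly_at d (p e) h t) (fun t => h k t ^ pred e)).
    - apply (zring_mult a b us1 (fun _ => INR e)); [apply zring_INR|].
      apply Hcoef; auto.
    - apply (subring_pow _ (h k) (pred e) HC); auto. }
  destruct (zring_derive a b us1 us I1 Hu1 sep Hsep) as (sep' & Hs1 & Hs2).
  assert (Hu : forall u, In u us -> exists u', zring a b us u' /\ derivs_on a b u u').
  { intros u [<-|Hu]; [|auto].
    exists (fun t => IZR (-1) * (sep' t * (w t * w t))). split.
    - apply (zring_mult a b us (fun _ => IZR (-1))); [apply zring_const|].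
      apply zring_mult; auto. apply zring_mult; auto.
    - intros t Ht. destruct (Hp t Ht) as [_ Hn]. fold sep in Hn.
      replace (IZR (-1) * (sep' t * (w t * w t))) with (- sep' t / sep t ^ 2)
        by (unfold w; simpl; field; auto).
      apply is_derive_Reals. apply is_derive_inv; auto. apply is_derive_Reals; auto. }
  exists us. induction l as [|l IH].
  - destruct (Nat.eq_dec k 0) as [E|n]; [rewrite E in Hk; auto|].
    apply (Hgen us I0); lia.
  - destruct (zring_derive a b us us (incl_refl _) Hu (h l) IH) as (g' & H1 & H2).
    apply zring_ext with (1 := H1). apply (derivs_on_unique a b (h l)); auto.
Qed.

(** * Dependence of many elements in a finitely generated span *)

Inductive lspan (a b : R) (L : list (R -> R)) : (R -> R) -> Prop :=
| lspan_0 : lspan a b L (fun _ => 0)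
| lspan_cons e z g : In e L -> lspan a b L g -> lspan a b L (fun t => IZR z * e t + g t)
| lspan_ext f g : lspan a b L f -> (forall t, a < t < b -> g t = f t) -> lspan a b L g.

Lemma lspan_gen a b L e : In e L -> lspan a b L e.
Proof.
  intros H. eapply lspan_ext; [exact (lspan_cons a b L e 1 _ H (lspan_0 a b L))|].
  intros; simpl; ring.
Qed.

Lemma lspan_plus a b L f g : lspan a b L f -> lspan a b L g -> lspan a b L (fun t => f t + g t).
Proof.
  intros Hf Hg; induction Hf as [|e z f He Hf IH|f f' Hf IH E].
  - eapply lspan_ext; [exact Hg|]. intros; simpl; ring.
  - eapply lspan_ext; [apply (lspan_cons a b L e z _ He IH)|]. intros; simpl; ring.
  - eapply lspan_ext; [exact IH|]. intros; simpl; rewrite E; auto.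
Qed.

Lemma lspan_scal a b L z f : lspan a b L f -> lspan a b L (fun t => IZR z * f t).
Proof.
  intros Hf; induction Hf as [|e y f He Hf IH|f f' Hf IH E].
  - eapply lspan_ext; [apply lspan_0|]. intros; simpl; ring.
  - eapply lspan_ext; [apply (lspan_cons a b L e (z * y) _ He IH)|].
    intros; simpl; rewrite mult_IZR; ring.
  - eapply lspan_ext; [exact IH|]. intros; simpl; rewrite E; auto.
Qed.

Lemma lspan_mult a b L L' L'' f g :
  (forall e e', In e L -> In e' L' -> In (fun t => e t * e' t) L'') ->
  lspan a b L f -> lspan a b L' g -> lspan a b L'' (fun t => f t * g t).
Proof.
  intros HL Hf Hg; induction Hf as [|e z f He Hf IH|f f' Hf IH E].
  - eapply lspan_ext; [apply lspan_0|]. intros; simpl; ring.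
  - assert (H : lspan a b L'' (fun t => e t * g t)).
    { clear IH. induction Hg as [|e' y g He' Hg IH|g g' Hg IH E].
      - eapply lspan_ext; [apply lspan_0|]. intros; simpl; ring.
      - eapply lspan_ext; [apply (lspan_cons a b L'' _ y _ (HL e e' He He') IH)|].
        intros; simpl; ring.
      - eapply lspan_ext; [exact IH|]. intros; simpl; rewrite E; auto. }
    eapply lspan_ext; [apply lspan_plus; [apply (lspan_scal a b L'' z _ H)|apply IH]|].
    intros; simpl; ring.
  - eapply lspan_ext; [exact IH|]. intros; simpl; rewrite E; auto.
Qed.

Lemma lspan_incl a b L L' f : incl L L' -> lspan a b L f -> lspan a b L' f.
Proof.
  intros HL Hf; induction Hf; [apply lspan_0|apply lspan_cons; auto|eapply lspan_ext; eauto].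
Qed.

(** All occurrences of the head are collected into one integer coefficient, the pivot entry for the
    elimination below. *)
Lemma lspan_head a b e L g : lspan a b (cons e L) g ->
  exists z g', lspan a b L g' /\ forall t, a < t < b -> g t = IZR z * e t + g' t.
Proof.
  intros H; induction H as [|e' y g [<-|He'] Hg (z & g' & H1 & H2)|f g Hf (z & g' & H1 & H2) E].
  - exists 0%Z, (fun _ => 0). split; [apply lspan_0|]. intros; ring.
  - exists (y + z)%Z, g'. split; auto. intros t Ht. rewrite H2, plus_IZR by auto. ring.
  - exists z, (fun t => IZR y * e' t + g' t). split; [apply lspan_cons; auto|].
    intros t Ht. rewrite H2 by auto. ring.
  - exists z, g'. split; auto. intros t Ht. rewrite E; auto.
Qed.

Definition lsum {T : Type} (F : T -> R) (l : list T) : R := fold_right (fun x s => F x + s) 0 l.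

Lemma lsum_app {T} (F : T -> R) l l' : lsum F (l ++ l') = lsum F l + lsum F l'.
Proof. induction l as [|x l IH]; simpl; [ring|]. rewrite IH; ring. Qed.

Lemma lsum_ext {T} (F G : T -> R) l : (forall x, In x l -> F x = G x) -> lsum F l = lsum G l.
Proof.
  induction l as [|x l IH]; simpl; intros H; [reflexivity|].
  rewrite H, IH; auto.
Qed.

Lemma lsum_lin {T} (F G : T -> R) x y l :
  lsum (fun i => x * F i + y * G i) l = x * lsum F l + y * lsum G l.
Proof. induction l as [|i l IH]; simpl; [ring|]. rewrite IH; ring. Qed.

(** Gaussian elimination without division. If some [x0] has coefficient c0 <> 0 on the head of [L],
    the combinations c0 G_x - c_x G_x0 are free of it, and one element is lost on each side;
    otherwise the head is dropped. Since the coefficients are indexed by elements of [B],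
    repetitions have to be excluded. *)
Lemma lspan_dependent {T : Type} a b L : forall (B : list T) (G : T -> R -> R),
  NoDup B -> (length L < length B)%nat -> (forall x, In x B -> lspan a b L (G x)) ->
  exists z : T -> Z, (exists x, In x B /\ z x <> 0%Z) /\
    forall t, a < t < b -> lsum (fun x => IZR (z x) * G x t) B = 0.
Proof.
  induction L as [|e L IH]; intros B G HB Hlen HG.
  - destruct B as [|x0 B]; [simpl in Hlen; lia|].
    exists (fun _ => 1%Z). split; [exists x0; split; [left; auto|lia]|].
    assert (Hnil : forall g, lspan a b nil g -> forall t, a < t < b -> g t = 0).
    { induction 1 as [|e z g []|f g Hf IHf E]; auto. intros t Ht; rewrite E; auto. }
    intros t Ht. transitivity (lsum (fun _ : T => 0 * 0 + 0 * 0) (cons x0 B)).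
    + apply lsum_ext. intros x Hx. rewrite (Hnil _ (HG x Hx) t Ht). ring.
    + rewrite lsum_lin. ring.
  - destruct (choice_fun (fun x (zg : Z * (R -> R)) => In x B -> lspan a b L (snd zg) /\
      forall t, a < t < b -> G x t = IZR (fst zg) * e t + snd zg t)) as [zg Hzg].
    { intros x. destruct (classic (In x B)) as [Hx|Hx]; [|exists (0%Z, fun _ => 0); tauto].
      destruct (lspan_head a b e L _ (HG x Hx)) as (z & g & H1 & H2). exists (z, g); auto. }
    destruct (classic (exists x, In x B /\ fst (zg x) <> 0%Z)) as [(x0 & Hx0 & Hz0)|Hno].
    2:{ apply IH; auto; [simpl in Hlen; lia|]. intros x Hx. destruct (Hzg x Hx) as [H1 H2].
        eapply lspan_ext; [exact H1|]. intros t Ht. rewrite H2 by auto.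
        replace (fst (zg x)) with 0%Z; [ring|]. apply NNPP; intros Hn; apply Hno.
        exists x; split; auto. }
    destruct (in_split x0 B Hx0) as (B1 & B2 & ->).
    assert (HB' := NoDup_remove_1 _ _ _ HB). assert (Hx0' := NoDup_remove_2 _ _ _ HB).
    assert (Hin : forall x, In x (B1 ++ B2) -> In x (B1 ++ cons x0 B2)).
    { intros x Hx. apply in_app_or in Hx. apply in_or_app. simpl. tauto. }
    set (c0 := fst (zg x0)) in *.
    destruct (IH (B1 ++ B2)%list (fun x t => IZR c0 * G x t - IZR (fst (zg x)) * G x0 t))
      as (z & (x1 & Hx1 & Hz1) & Hz); auto.
    { rewrite length_app in *. simpl in Hlen. lia. }
    { intros x Hx. destruct (Hzg x (Hin x Hx)) as [H1 H2]. destruct (Hzg x0 Hx0) as [H3 H4].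
      eapply lspan_ext;
        [apply lspan_plus; [apply (lspan_scal a b L c0 _ H1)
                           |apply (lspan_scal a b L (- fst (zg x)) _ H3)]|].
      intros t Ht. simpl. rewrite H2, H4 by auto. rewrite opp_IZR. fold c0. ring. }
    assert (Hy : exists y, IZR y = lsum (fun x => IZR (z x * fst (zg x))) (B1 ++ B2)).
    { clear. induction (B1 ++ B2)%list as [|x l [y IH]]; [exists 0%Z; reflexivity|].
      exists (z x * fst (zg x) + y)%Z. rewrite plus_IZR, IH. reflexivity. }
    destruct Hy as [y Hy].
    (* Expanding the sum of z_x (c0 G_x - c_x G_x0) leaves c0 z_x on G_x and - y on G_x0. It stays
       nontrivial because c0 and z at [x1] are nonzero. *)
    exists (fun x => if excluded_middle_informative (x = x0) then - y else c0 * z x)%Z.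
    split.
    + exists x1. split; auto.
      destruct (excluded_middle_informative (x1 = x0)) as [->|_]; [contradiction|].
      intros E. apply Z.mul_eq_0 in E. tauto.
    + intros t Ht. rewrite lsum_app. cbn [lsum fold_right].
      destruct (excluded_middle_informative (x0 = x0)) as [_|n]; [|contradiction].
      fold (lsum (fun x : T =>
        IZR (if excluded_middle_informative (x = x0) then - y else c0 * z x) * G x t) B2).
      match goal with |- ?A + (?B + ?C) = 0 => replace (A + (B + C)) with ((A + C) + B) by ring end.
      rewrite <- lsum_app.
      rewrite (lsum_ext _ (fun x => 1 * (IZR (z x) * (IZR c0 * G x t - IZR (fst (zg x)) * G x0 t))
         + G x0 t * IZR (z x * fst (zg x)))).
      * rewrite lsum_lin, Hz, opp_IZR, Hy by auto. ring.
      * intros x Hx. destruct (excluded_middle_informative (x = x0)) as [->|_]; [contradiction|].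
        rewrite !mult_IZR. ring.
Qed.

(** * Counting monomials, and (iii_R) => (iv) *)

Lemma flat_map_map_length {A B C : Type} (F : A -> B -> C) l (s : list A) :
  length (flat_map (fun e => map (F e) l) s) = (length s * length l)%nat.
Proof.
  induction s as [|e s IH]; simpl; [reflexivity|].
  rewrite length_app, length_map, IH. reflexivity.
Qed.

Fixpoint monos (us : list (R -> R)) (D : nat) : list (R -> R) :=
  match us with
  | nil => cons (fun _ => 1) nil
  | cons u us' => flat_map (fun e => map (fun f t => u t ^ e * f t) (monos us' D)) (seq 0 (S D))
  end.

Lemma monos_length us D : length (monos us D) = (S D ^ length us)%nat.
Proof.
  induction us as [|u us IH]; [reflexivity|].
  cbn [monos]. rewrite (flat_map_map_length (fun e f t => u t ^ e * f t)), IH, length_seq.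
  reflexivity.
Qed.

Lemma monos_cons u us D e f g : (e <= D)%nat -> In f (monos us D) ->
  (forall t, g t = u t ^ e * f t) -> In g (monos (cons u us) D).
Proof.
  intros He Hf E. cbn [monos]. apply in_flat_map. exists e. split; [apply in_seq; lia|].
  apply in_map_iff. exists f. split; auto.
  apply functional_extensionality; intros t; symmetry; apply E.
Qed.

Lemma monos_inv u us D g : In g (monos (cons u us) D) ->
  exists e f, (e <= D)%nat /\ In f (monos us D) /\ g = fun t => u t ^ e * f t.
Proof.
  cbn [monos]. rewrite in_flat_map. intros (e & He & Hg). apply in_seq in He.
  apply in_map_iff in Hg as (f & <- & Hf). exists e, f. repeat split; auto; lia.
Qed.

Lemma monos_one us D : In (fun _ => 1) (monos us D).
Proof.
  induction us as [|u us IH]; [left; reflexivity|].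
  apply monos_cons with (2 := IH) (e := 0%nat); [lia|]. intros; simpl; ring.
Qed.

Lemma monos_gen us u : In u us -> In u (monos us 1).
Proof.
  induction us as [|v us IH]; intros [].
  - subst. apply monos_cons with (2 := monos_one us 1) (e := 1%nat); [lia|]. intros; simpl; ring.
  - apply monos_cons with (2 := IH H) (e := 0%nat); [lia|]. intros; simpl; ring.
Qed.

Lemma monos_incl us D E : (D <= E)%nat -> incl (monos us D) (monos us E).
Proof.
  intros HD; induction us as [|u us IH]; intros g Hg; [exact Hg|].
  apply monos_inv in Hg as (e & f & He & Hf & ->).
  apply monos_cons with (2 := IH f Hf) (e := e); [lia|]. reflexivity.
Qed.

Lemma monos_mult us D E f g :
  In f (monos us D) -> In g (monos us E) -> In (fun t => f t * g t) (monos us (D + E)).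
Proof.
  revert f g; induction us as [|u us IH]; intros f g Hf Hg.
  - destruct Hf as [<-|[]], Hg as [<-|[]]. left.
    apply functional_extensionality; intros; ring.
  - apply monos_inv in Hf as (e & f0 & He & Hf & ->).
    apply monos_inv in Hg as (e' & g0 & He' & Hg & ->).
    apply monos_cons with (2 := IH f0 g0 Hf Hg) (e := (e + e')%nat); [lia|].
    intros t; rewrite pow_add; ring.
Qed.

Lemma lspan_monos_incl a b us D E f : (D <= E)%nat ->
  lspan a b (monos us D) f -> lspan a b (monos us E) f.
Proof. intros H; apply lspan_incl, monos_incl, H. Qed.

Lemma lspan_monos_mult a b us D E f g :
  lspan a b (monos us D) f -> lspan a b (monos us E) g ->
  lspan a b (monos us (D + E)) (fun t => f t * g t).
Proof. apply lspan_mult. intros; apply monos_mult; auto. Qed.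

(** Every ring element is an integer polynomial in the generators, of some degree: sums take the
    maximum of the degrees and products add them. *)
Lemma zring_lspan a b us g : zring a b us g -> exists D, lspan a b (monos us D) g.
Proof.
  induction 1 as [z|u Hu|f g _ [D HD] _ [E HE]|f g _ [D HD] _ [E HE]|f g _ [D HD] E].
  - exists 0%nat. eapply lspan_ext;
      [apply (lspan_scal a b _ z _ (lspan_gen a b _ _ (monos_one us 0)))|].
    intros; simpl; ring.
  - exists 1%nat. apply lspan_gen, monos_gen, Hu.
  - exists (max D E). apply lspan_plus; [apply lspan_monos_incl with D|apply lspan_monos_incl with E]; auto; lia.
  - exists (D + E)%nat. apply lspan_monos_mult; auto.
  - exists D. eapply lspan_ext; eauto.
Qed.

Lemma lspan_monos_pow a b us D f n :
  lspan a b (monos us D) f -> lspan a b (monos us (n * D)) (fun t => f t ^ n).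
Proof.
  intros H; induction n as [|n IH]; [apply lspan_gen, monos_one|].
  apply (lspan_monos_mult a b us D (n * D)); auto.
Qed.

Lemma lspan_monos_prod a b us D k (F : Fin.t k -> R -> R) :
  (forall j, lspan a b (monos us D) (F j)) ->
  lspan a b (monos us (k * D)) (fun t => prod_fin k (fun j => F j t)).
Proof.
  intros H; induction k as [|k IH]; [apply lspan_gen, monos_one|].
  apply (lspan_monos_mult a b us D (k * D)); auto.
Qed.

Lemma boxlist_length k d : length (boxlist k d) = (S d ^ k)%nat.
Proof.
  induction k as [|k IH]; [reflexivity|].
  cbn [boxlist]. etransitivity; [apply flat_map_map_length|].
  rewrite length_seq, Nat.pow_succ_r'. f_equal. exact IH.
Qed.

Lemma boxlist_NoDup k d : NoDup (boxlist k d).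
Proof.
  induction k as [|k IH]; [repeat constructor; auto|].
  cbn [boxlist]. assert (Hs := seq_NoDup (S d) 0). revert Hs.
  generalize (seq 0 (S d)) as s. induction 1 as [|e s He Hs IHs]; [constructor|].
  simpl. apply NoDup_app; auto.
  - apply FinFun.Injective_map_NoDup; auto. intros x y E.
    apply (f_equal (fun (h : mindex (S k)) j => h (Fin.FS j))) in E. exact E.
  - intros c Hc Hc'. apply in_map_iff in Hc as (x & <- & _).
    apply in_flat_map in Hc' as (e' & He' & Hc'). apply in_map_iff in Hc' as (y & E & _).
    apply (f_equal (fun h : mindex (S k) => h Fin.F1)) in E. simpl in E. congruence.
Qed.

Lemma lsum_map {A B} (F : B -> R) (g : A -> B) l : lsum F (map g l) = lsum (fun x => F (g x)) l.
Proof. induction l as [|x l IH]; simpl; [reflexivity|]. rewrite IH; reflexivity. Qed.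

Lemma sum_box_lsum k d (F : mindex k -> R) : sum_box k d F = lsum F (boxlist k d).
Proof.
  induction k as [|k IH]; [simpl; ring|].
  cbn [boxlist sum_box].
  assert (H : forall n, sum_f_R0 (fun e => sum_box k d (fun a => F (fin_cons e a))) n
    = lsum F (flat_map (fun e => map (fin_cons e) (boxlist k d)) (seq 0 (S n)))).
  { induction n as [|n IHn].
    - simpl. rewrite app_nil_r, lsum_map, IH. reflexivity.
    - rewrite seq_S, flat_map_app, lsum_app, <- IHn. simpl.
      rewrite app_nil_r, lsum_map, IH. reflexivity. }
  apply H.
Qed.

(** The base on the left is at most K(d+1) with K = (q+1)C + 1, so the left side is at most K^q
    (d+1)^q; with d = K^q this is d (d+1)^q, less than (d+1)^(q+1). *)
Lemma box_count q C : exists d, (S (S q * (C * d)) ^ q < S d ^ S q)%nat.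
Proof.
  set (K := S (S q * C)). exists (K ^ q)%nat. set (d := (K ^ q)%nat).
  apply Nat.le_lt_trans with ((K * S d) ^ q)%nat.
  - apply Nat.pow_le_mono_l. unfold K. nia.
  - rewrite Nat.pow_mul_l. fold d. rewrite Nat.pow_succ_r'.
    apply Nat.mul_lt_mono_pos_r; [|lia].
    apply Nat.neq_0_lt_0, Nat.pow_nonzero. lia.
Qed.

(* Monomials of degree <= d in S q of the h_l outnumber, for large d, the monomials of degree
   O(d) in the q generators in which they all lie. *)
Lemma zring_dependent a b us (h : nat -> R -> R) :
  (forall l, zring a b us (h l)) ->
  exists k (P : mpoly k), mp_nonzero P /\ mp_intcoef P /\
    forall t, a < t < b -> mp_eval P (fun l => h (fval l) t) = 0.
Proof.
  intros Hh. set (q := length us).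
  assert (HC : forall N, exists C, forall l, (l <= N)%nat -> lspan a b (monos us C) (h l)).
  { induction N as [|N [C HC]].
    - destruct (zring_lspan _ _ _ _ (Hh 0%nat)) as [C HC]. exists C; intros l Hl.
      replace l with 0%nat by lia; auto.
    - destruct (zring_lspan _ _ _ _ (Hh (S N))) as [C' HC']. exists (max C C'); intros l Hl.
      destruct (Nat.eq_dec l (S N)) as [->|n].
      + apply lspan_monos_incl with C'; auto; lia.
      + apply lspan_monos_incl with C; [lia|]. apply HC; lia. }
  destruct (HC q) as [C HCq]. destruct (box_count q C) as [d Hd].
  destruct (lspan_dependent a b (monos us (S q * (C * d))) (boxlist (S q) d)
    (fun al t => prod_fin (S q) (fun j => h (fval j) t ^ al j))) as (z & (al & Hal & Hz) & Hsum).
  - apply boxlist_NoDup.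
  - rewrite monos_length, boxlist_length. exact Hd.
  - intros al Hal. apply boxlist_in in Hal.
    apply (lspan_monos_prod a b us (C * d) (S q) (fun j t => h (fval j) t ^ al j)).
    (* Each of the q+1 powers has exponent at most d and base of degree at most C, which gives the
       total (q+1) C d. *)
    intros j. apply lspan_monos_incl with (al j * C)%nat.
    + rewrite Nat.mul_comm. apply Nat.mul_le_mono_l, Hal.
    + apply lspan_monos_pow, HCq. unfold fval. destruct (Fin.to_nat j) as [v Hv]; simpl; lia.
  - exists (S q), (MPoly (S q) d (fun al => IZR (z al))). split; [|split].
    + exists al. split; [apply boxlist_in; auto|]. simpl. apply not_0_IZR; auto.
    + intros be _. exists (z be). reflexivity.
    + intros t Ht. unfold mp_eval. rewrite sum_box_lsum. apply Hsum; auto.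
Qed.

Lemma iiiR_iv {m n} (i : Fin.t m) dom (f : vec m -> vec n) :
  analytic dom f -> stmt_iii false dom f i -> stmt_iv dom f i.
Proof.
  intros [Ho Ha] H x0 Hx0.
  destruct (H x0 Hx0) as (k & P & a0 & b0 & HP & Hab & Hs).
  destruct (Ho x0 Hx0) as (r & Hr & Hb).
  (* The point is written as the set of all x equal to [x0], so that the relations found for the
     separate components can be given a common arity. *)
  cut (exists k (Q : Fin.t n -> mpoly k), admissible true Q /\ forall x, x = x0 -> star f i Q x).
  { intros (k' & Q & HQ & HQs). exists k', Q; auto. }
  apply common_arity_jet. intros j. set (g := fun z => f z j).
  (* The interval is cut down so that the whole coordinate segment lies in the domain, where the
     derivatives exist. *)
  set (a := Rmax a0 (x0 i - r)). set (b := Rmin b0 (x0 i + r)).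
  assert (Ha1 : a0 <= a) by apply Rmax_l. assert (Ha2 : x0 i - r <= a) by apply Rmax_r.
  assert (Hb1 : b <= b0) by apply Rmin_l. assert (Hb2 : b <= x0 i + r) by apply Rmin_r.
  assert (Hax : a < x0 i) by (apply Rmax_lub_lt; lra).
  assert (Hxb : x0 i < b) by (apply Rmin_glb_lt; lra).
  assert (Hdom : forall t, a < t < b -> dom (upd x0 i t)).
  { intros t Ht. apply Hb, in_ball_upd; [apply in_ball_center; auto|]. apply Rabs_def1; lra. }
  set (h := fun l t => pderivn i l g (upd x0 i t)).
  assert (Hh : forall l, derivs_on a b (h l) (h (S l))).
  { intros l t Ht.
    assert (E := pderivn_derivable dom g i (upd x0 i t) l (Ha _ (Hdom t Ht) j)).
    rewrite upd_same in E.
    replace (fun s => pderivn i l g (upd (upd x0 i t) i s)) with (h l) in E; [exact E|].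
    apply functional_extensionality; intros s. rewrite upd_upd. reflexivity. }
  destruct (nonsingular_relation h a b k (mp_deg (P j)) (mp_coef (P j)))
    as (k' & D & p & a' & b' & H1 & H2 & H3 & H4).
  - intros l t Ht. apply derivable_continuous_pt. exists (h (S l) t). apply Hh; auto.
  - lra.
  - apply (HP j).
  - intros t Ht. apply (Hs t); [lra|auto].
  - destruct (jets_in_zring h a' b' (mp_deg (P j)) D p) as [us Hus]; auto.
    { intros l t Ht; apply Hh; lra. }
    destruct (zring_dependent a' b' us h Hus) as (q & Q & HQ1 & HQ2 & HQ3).
    exists q, Q. split; auto. split; auto. intros x ->.
    (* (a',b') may miss [x0 i]. The integer relation holds around its midpoint and is continued
       along the coordinate segment from there to [x0]. *)
    set (t1 := (a' + b') / 2). set (y := upd x0 i t1).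
    destruct (line_in_ball y (fun l => x0 l - y l) 0 ((b' - a') / 2)) as (e & He & Hl); [lra|].
    assert (Hline : forall t, line y (fun l => x0 l - y l) t
      = upd x0 i (t1 + t * (x0 i - t1))).
    { intros t. apply functional_extensionality; intros l. unfold line, y, upd.
      destruct (Fin.eq_dec l i); [subst; reflexivity|ring]. }
    apply (jet_eval_segment dom g i Q y x0 e); auto.
    + intros t Ht. rewrite Hline. apply (Ha (upd x0 i (t1 + t * (x0 i - t1)))), Hdom.
      assert (Ht1 : a < t1 < b) by (unfold t1; lra).
      assert (G1 := convex_comb_lt t1 (x0 i) b t ltac:(lra) Hxb Ht).
      assert (G2 := convex_comb_lt (- t1) (- x0 i) (- a) t ltac:(lra) ltac:(lra) Ht). lra.
    + intros t Ht. rewrite Hline. apply (HQ3 (t1 + t * (x0 i - t1))).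
      assert (E := Hl t ltac:(rewrite Rminus_0_r, Rabs_pos_eq; lra) i).
      rewrite line_0, Hline, upd_same in E. unfold y in E. rewrite upd_same in E.
      apply Rabs_def2 in E. unfold t1 in *. lra.
Qed.

(** * The elementary implications and the assembly *)

Lemma stmt_i_ii {m n} intc (i : Fin.t m) dom (f : vec m -> vec n) :
  is_open dom -> stmt_i intc dom f i -> stmt_ii intc dom f i.
Proof.
  intros Ho H x0 Hx0. destruct (Ho x0 Hx0) as (r & Hr & Hb).
  destruct (H (in_ball x0 r)) as (k & P & H1 & H2); auto.
  - apply ball_open.
  - apply ball_connected.
  - exists k, P, (in_ball x0 r). split; auto. split; [apply ball_open|].
    split; [apply in_ball_center; auto|]. auto.
Qed.

Lemma stmt_ii_iii {m n} intc (i : Fin.t m) dom (f : vec m -> vec n) :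
  stmt_ii intc dom f i -> stmt_iii intc dom f i.
Proof.
  intros H x0 Hx0. destruct (H x0 Hx0) as (k & P & J & H1 & HJ & Hx & _ & Hs).
  destruct (HJ x0 Hx) as (r & Hr & Hb).
  exists k, P, (x0 i - r), (x0 i + r). split; auto. split; [lra|].
  intros t Ht _. apply Hs, Hb, in_ball_upd; [apply in_ball_center; auto|].
  apply Rabs_def1; lra.
Qed.

Lemma admissible_weaken {n k} (P : Fin.t n -> mpoly k) : admissible true P -> admissible false P.
Proof. intros H j; split; [apply H|exact I]. Qed.

Theorem theorem2p1 (m n : nat) (i : Fin.t m)
    (dom : vec m -> Prop) (f : vec m -> vec n) (Hf : analytic dom f) :
  (stmt_i true dom f i <-> stmt_ii true dom f i) /\
  (stmt_i true dom f i <-> stmt_iii true dom f i) /\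
  (stmt_i true dom f i <-> stmt_iv dom f i) /\
  (stmt_i true dom f i <-> stmt_i false dom f i) /\
  (stmt_i true dom f i <-> stmt_ii false dom f i) /\
  (stmt_i true dom f i <-> stmt_iii false dom f i).
Proof.
  assert (Ho := proj1 Hf).
  assert (E1 := fun b => stmt_i_ii b i dom f Ho).
  assert (E2 := fun b => stmt_ii_iii b i dom f).
  assert (E3 := iiiR_iv i dom f Hf).
  assert (E4 := iv_i i dom f Hf).
  assert (W1 : stmt_i true dom f i -> stmt_i false dom f i).
  { intros H J HJ Hc Hs. destruct (H J HJ Hc Hs) as (k & P & HP & HPs).
    exists k, P; split; [apply admissible_weaken; auto|auto]. }
  (* (iii) reaches (iv) through (iii_R): an integer relation is in particular a real one. *)
  assert (W3 : stmt_iii true dom f i -> stmt_iii false dom f i).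
  { intros H x Hx. destruct (H x Hx) as (k & P & a & b & HP & HPs).
    exists k, P, a, b; split; [apply admissible_weaken; auto|auto]. }
  assert (F1 := E1 true). assert (F2 := E2 true). assert (F3 := E1 false). assert (F4 := E2 false).
  repeat split; tauto.
Qed.
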